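(* Let $\Lambda$ be a smooth manifold, let $\mathcal G=\{G_\lambda:\lambda\in\Lambda\}$ be a (smooth) bundle of Lie groups over $\Lambda$ acting by diffeomorphisms on a Banach manifold $X$, and suppose that the action is regular. Let $f_\lambda\colon X\to\mathbb R$, $\lambda\in\Lambda$, be a smooth family of smooth functionals such that $f_\lambda(g\cdot x)=f_\lambda(x)$ for all $\lambda\in\Lambda$, $x\in X$ and $g\in G_\lambda$. Let $(\lambda_0,x_0)\in\Lambda\times X$ be such that $\mathrm d f_{\lambda_0}(x_0)=0$, and assume that $x_0$ is an equivariantly nondegenerate critical point of $f_{\lambda_0}$. Assume that the second variation $\mathrm d^2 f_{\lambda_0}(x_0)$ is represented by a self-adjoint Fredholm operator (in the sense specified in the context). Then there exist an open neighborhood $U\subset\Lambda$ of $\lambda_0$, an open neighborhood $V\subset X$ of $x_0$ and a map $U\ni\lambda\mapsto x_\lambda\in V$ such that $(\lambda,x)\in U\times V$ is a solution of $\mathrm d f_\lambda(x)=0$ if and only if $x$ is in the $G_\lambda$-orbit of $x_\lambda$.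
   Context: **Bundle of Lie groups.** A (smooth) bundle of Lie groups over a (connected) smooth manifold $\Lambda$ is a Lie groupoid $\mathcal G$ over $\Lambda$ whose source and target maps coincide. Explicitly: $\mathcal G$ is a smooth manifold with a smooth submersion $\mathfrak s\colon\mathcal G\to\Lambda$; each fiber $G_\lambda=\mathfrak s^{-1}(\lambda)$ is a group; and the composition $\mathcal G\times_\Lambda\mathcal G\to\mathcal G$, the inversion $\mathcal G\to\mathcal G$ and the unit section $\lambda\mapsto 1_\lambda$ are smooth. The Lie algebras $\mathfrak g_\lambda$ of $G_\lambda$ form a smooth vector bundle $\mathfrak g$ over $\Lambda$. **Action.** $\mathcal G$ acts on $X$ by diffeomorphisms if each $G_\lambda$ acts on $X$ by diffeomorphisms; the action is understood to be continuous, i.e. $\mathcal G\times X\ni(g,x)\mapsto g\cdot x\in X$ is continuous. Put $\beta^\lambda_x\colon G_\lambda\to X$, $\beta^\lambda_x(g)=g\cdot x$. The action is *regular* if $\beta_x^\lambda$ is differentiable at $1_\lambda$ for all $\lambda$ and $x$, and $(\lambda,x)\mapsto \mathrm d\beta_x^\lambda(1_\lambda)$ is a continuous section of the vector bundle $\mathrm{Hom}(\mathfrak g,TX)$ over $\Lambda\times X$ whose fiber over $(\lambda,x)$ is the space of linear maps $\mathfrak g_\lambda\to T_xX$. Let $\mathcal D_x^\lambda\subset T_xX$ be the image of $\mathrm d\beta_x^\lambda(1_\lambda)$. **Equivariant nondegeneracy.** If $x$ is a critical point of $f_\lambda$, then $\ker\mathrm d^2f_\lambda(x)\supset\mathcal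 D_x^\lambda$. The critical point $x$ is *equivariantly nondegenerate* if $\ker \mathrm d^2f_\lambda(x)=\mathcal D_x^\lambda$. **Smooth family.** $(\lambda,x)\mapsto f_\lambda(x)$ is smooth on $\Lambda\times X$. **Fredholmness assumption (auxiliary Fredholm structure).** There are a smooth Banach bundle $\mathcal E$ on $X$ with a continuous inclusion $TX\subset\mathcal E$ and a (possibly non-complete) inner product $\langle\cdot,\cdot\rangle_x$ on each fiber $\mathcal E_x$, such that, for some $k\ge1$, the induced map $\mathcal E\to TX^*$, $e\mapsto\langle e,\cdot\rangle_x$, is a $C^k$ bundle morphism, and: - for each $\lambda$ there is a section $\delta f_\lambda\colon X\to\mathcal E$ with $\mathrm d f_\lambda(x)=\langle\delta f_\lambda(x),\cdot\rangle_x$ on $T_xX$ for all $x\in X$, with $(\lambda,x)\mapsto\delta f_\lambda(x)$ of class $C^k$, and $\mathrm d f_\lambda(x)=0$ if and only if $\delta f_\lambda(x)=0$; - there is a Fredholm operator $J_{x_0}\colon T_{x_0}X\to\mathcal E_{x_0}$ of index $0$ such that $\mathrm d^2 f_{\lambda_0}(x_0)[v,w]=\langle J_{x_0}(v),w\rangle_{x_0}$ for all $v,w\in T_{x_0}X$; $J_{x_0}$ is the vertical derivative of $\delta f_{\lambda_0}$ at $x_0$, i.e. $J_{x_0}=\pi_{\mathrm{ver}}\circ\mathrm d(\delta f_{\lambda_0})(x_0)$, where $\pi_{\mathrm{ver}}\colon T_{0_{x_0}}\mathcal E\to\mathcal E_{x_0}$ is the vertical projection at the zero of the fiber $\mathcal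 E_{x_0}$. *)

(* Defs.v *)
From HB Require Import structures.
From mathcomp Require Import all_boot all_order all_algebra.
From mathcomp Require Import all_classical all_reals all_analysis.

Set Implicit Arguments.
Unset Strict Implicit.
Unset Printing Implicit Defensive.

Import Order.TTheory GRing.Theory Num.Theory.
Import numFieldNormedType.Exports.

Local Open Scope classical_set_scope.
Local Open Scope ring_scope.

Section BoundedLinear.
Context {R : realType} (U V : normedModType R).

Definition bl_pred : {pred U -> V} := fun f => `[< linear f /\ continuous f >].

Lemma bl_submod_closed : submod_closed bl_pred.
Proof.
split.
  apply/asboolP; split; first by move=> a x y; rewrite scaler0 addr0.
  exact: cst_continuous.
move=> a f g /asboolP[lf cf] /asboolP[lg cg]; apply/asboolP; split.
  move=> b x y; rewrite /= !fctE lf lg !scalerDr !scalerA (mulrC a b).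
  by rewrite addrACA.
move=> x; apply: cvgD; [apply: cvgZl_tmp; exact: cf|exact: cg].
Qed.

HB.instance Definition _ :=
  GRing.isSubmodClosed.Build R (U -> V) bl_pred bl_submod_closed.

Record BL := MkBL { bl_fun :> U -> V; _ : bl_fun \in bl_pred }.

HB.instance Definition _ := [isSub for bl_fun].
HB.instance Definition _ := [Choice of BL by <:].
HB.instance Definition _ := [SubChoice_isSubLmodule of BL by <:].

Lemma bl_linear (f : BL) : linear f.
Proof. by case: f => f Pf; have /asboolP[] := Pf. Qed.

Lemma bl_continuous (f : BL) : continuous f.
Proof. by case: f => f Pf; have /asboolP[] := Pf. Qed.

Definition opnorm (f : BL) : R := sup [set `|f x| | x in [set x | `|x| <= 1]].

Lemma bl0 (f : BL) : f 0 = 0.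
Proof. by have := bl_linear f 1 0 0; rewrite scale1r !addr0 scale1r => /eqP;
  rewrite -subr_eq subrr eq_sym => /eqP. Qed.

Lemma blZ (f : BL) a x : f (a *: x) = a *: f x.
Proof. by have := bl_linear f a x 0; rewrite bl0 !addr0. Qed.

Lemma opnorm_has_sup (f : BL) :
  has_sup [set `|f x| | x in [set x | `|x| <= 1]].
Proof.
split; first by exists `|f 0|; exists 0 => //=; rewrite normr0.
have /cvgrPdist_lt/(_ 1 ltr01) := bl_continuous (f := f) (x := 0).
rewrite bl0 => /nbhs_normP[e /= e0 be].
exists (2 / e) => _ [x /= x1 <-].
have : ball_ Num.norm (0 : U) e ((e / 2) *: x).
  rewrite /ball_ /= sub0r normrN normrZ gtr0_norm ?divr_gt0//.
  by rewrite (le_lt_trans (ler_wpM2l _ x1)) ?divr_ge0 ?ltW// mulr1 gtr_pMr// invf_lt1// ltr1n.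
move=> /be /=; rewrite sub0r normrN blZ normrZ gtr0_norm ?divr_gt0//.
by rewrite -ltr_pdivlMl ?divr_gt0// mulr1 invf_div => /ltW.
Qed.

Lemma opnorm_ub (f : BL) x : `|x| <= 1 -> `|f x| <= opnorm f.
Proof.
by move=> x1; apply: sup_upper_bound; [exact: opnorm_has_sup|exists x].
Qed.

Lemma opnorm_le (f : BL) M : (forall x, `|x| <= 1 -> `|f x| <= M) -> opnorm f <= M.
Proof.
move=> fM; apply: ge_sup; first by case: (opnorm_has_sup f).
by move=> _ [x x1 <-]; exact: fM.
Qed.

Lemma bl_addE (f g : BL) x : (f + g) x = f x + g x. Proof. by []. Qed.
Lemma bl_scaleE a (f : BL) x : (a *: f) x = a *: f x. Proof. by []. Qed.

Lemma ler_opnormD (f g : BL) : opnorm (f + g) <= opnorm f + opnorm g.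
Proof.
apply: opnorm_le => x x1; rewrite bl_addE (le_trans (ler_normD _ _))//.
by rewrite lerD// opnorm_ub.
Qed.

Lemma opnormZ a (f : BL) : opnorm (a *: f) = `|a| * opnorm f.
Proof.
apply/eqP; rewrite eq_le; apply/andP; split.
  by apply: opnorm_le => x x1; rewrite bl_scaleE normrZ ler_wpM2l// opnorm_ub.
have [->|a0] := eqVneq a 0.
  rewrite normr0 mul0r (le_trans _ (@opnorm_ub _ 0 _))// ?normr0//.
rewrite -ler_pdivlMl ?normr_gt0//; apply: opnorm_le => x x1.
by rewrite ler_pdivlMl ?normr_gt0// -normrZ -bl_scaleE opnorm_ub.
Qed.

Lemma opnorm_eq0 (f : BL) : opnorm f = 0 -> f = 0.
Proof.
move=> f0; apply/val_inj/funext => x; change (f x = 0).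
have [->|x0] := eqVneq x 0; first exact: bl0.
have : `|f (`|x|^-1 *: x)| <= 0.
  by rewrite -f0 opnorm_ub// normrZ normfV normr_id mulVf// normr_eq0.
by rewrite normr_le0 blZ scaler_eq0 invr_eq0 normr_eq0 (negbTE x0) => /eqP.
Qed.

HB.instance Definition _ :=
  Lmodule_isNormed.Build R BL ler_opnormD opnormZ opnorm_eq0.

End BoundedLinear.

Section Calculus.
Context {R : realType}.
Implicit Types U V : normedModType R.

(* 0 is a junk value, taken when f is not linear and continuous. *)
Definition toBL U V (f : U -> V) : BL U V :=
  xget 0 [set L : BL U V | bl_fun L = f].

Definition dBL U V (f : U -> V) (x : U) : BL U V := toBL ('d f x).

(* Fréchet class C^k on an open set A; the derivative is a map to L(U, V) with
   the operator norm. *)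
Fixpoint Ck (k : nat) U V (A : set U) (f : U -> V) : Prop :=
  match k with
  | 0%N => forall x, A x -> {for x, continuous f}
  | k'.+1 => (forall x, A x -> differentiable f x) /\ Ck k' A (dBL f)
  end.

Definition smooth U V (A : set U) (f : U -> V) : Prop := forall k, Ck k A f.

Definition is_bilinear U (b : U -> U -> R) : Prop :=
  (forall v, linear (b v : U -> R^o)) /\ (forall w, linear (b^~ w : U -> R^o)).

(* dimension of a subspace A of U *)
Definition has_dim U (A : set U) (d : nat) : Prop :=
  exists b : 'I_d -> U, (forall i, A (b i)) /\
    forall v, A v -> exists! a : 'rV[R]_d, v = \sum_i a ord0 i *: b i.

(* dimension of the quotient of U by a subspace A *)
Definition has_codim U (A : set U) (d : nat) : Prop :=
  exists b : 'I_d -> U,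
    forall v, exists! a : 'rV[R]_d, A (v - \sum_i a ord0 i *: b i).

Definition fredholm U V (J : BL U V) (i : int) : Prop :=
  closed (range J) /\
  exists k c, [/\ has_dim [set v | J v = 0] k, has_codim (range J) c &
                  i = k%:Z - c%:Z].

End Calculus.

Section Manifold.
Context {R : realType}.

(* [cinv] is constrained on [ccod] only, [cmap] on [cdom] only. *)
Record chart (M : topologicalType) (E : normedModType R) := Chart {
  cdom : set M;
  cmap :> M -> E;
  cinv : E -> M;
  cdom_open : open cdom;
  ccod_open : open (cmap @` cdom);
  cmapK : forall x, cdom x -> cinv (cmap x) = x;
  cmap_continuous : forall x, cdom x -> {for x, continuous cmap};
  cinv_continuous :
    forall y, (cmap @` cdom) y -> {for y, continuous cinv} }.

Definition ccod (M : topologicalType) (E : normedModType R) (c : chart M E) :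
  set E := c @` cdom c.

Definition compatible (M : topologicalType) (E : normedModType R)
    (c d : chart M E) : Prop :=
  smooth (c @` (cdom c `&` cdom d)) (d \o cinv c) /\
  smooth (d @` (cdom c `&` cdom d)) (c \o cinv d).

Record manifold (E : normedModType R) := Manifold {
  msort :> topologicalType;
  atlas : set (chart msort E);
  manifold_hausdorff : hausdorff_space msort;
  atlas_cover : forall x, exists2 c, atlas c & cdom c x;
  atlas_compatible : forall c d, atlas c -> atlas d -> compatible c d;
  atlas_maximal :
    forall c, (forall d, atlas d -> compatible c d) -> atlas c }.

End Manifold.

Section Tangent.
Context {R : realType} {E : normedModType R}.
Implicit Types M : manifold E.

Definition chart_at M (x : M) : chart M E := s2val (cid2 (atlas_cover x)).

(* The tangent space at x is represented by the model space through the
   reference chart [chart_at x]; a chart c around x then identifies it with E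
   by the derivative of the change of charts, whose inverse is [tvec c x]. *)
Definition tangent M (x : M) : normedModType R := E.

Definition tvec M (c : chart M E) (x : M) : E -> tangent x :=
  'd (chart_at x \o cinv c) (c x).

End Tangent.

Section SmoothMaps.
Context {R : realType} {E F : normedModType R}.
Implicit Types (M : manifold E) (N : manifold F).

Definition smooth_map M N (f : M -> N) : Prop :=
  continuous f /\
  forall c d, atlas c -> atlas d ->
    smooth (c @` (cdom c `&` f @^-1` cdom d)) (d \o f \o cinv c).

Definition mdiff M N (f : M -> N) (x : M) : tangent x -> tangent (f x) :=
  'd (chart_at (f x) \o f \o cinv (chart_at x)) (chart_at x x).

Arguments mdiff {M N} f x _.

Definition submersion M N (f : M -> N) : Prop :=
  smooth_map f /\ forall x w, exists v, mdiff f x v = w.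

Definition fdiff M (f : M -> R) (x : M) : tangent x -> R :=
  'd (f \o cinv (chart_at x) : E -> R^o) (chart_at x x).

Definition critical M (f : M -> R) (x : M) : Prop :=
  forall v : tangent x, @fdiff M f x v = 0.

(* second variation, chart-independent at critical points of f *)
Definition hessian M (f : M -> R) (x : M) (v w : tangent x) : R :=
  'd (fun y => 'd (f \o cinv (chart_at x) : E -> R^o) y w : R^o)
     (chart_at x x) v.

Definition smooth_family M N (f : M -> N -> R) : Prop :=
  forall (c : chart M E) (d : chart N F), atlas c -> atlas d ->
    smooth (ccod c `*` ccod d)
      (fun p : E * F => f (cinv c p.1) (cinv d p.2) : R^o).

End SmoothMaps.

Arguments mdiff {R E F M N} f x _.
Arguments fdiff {R E M} f x _.
Arguments hessian {R E M} f x _ _.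

Definition diffeomorphism {R : realType} {E : normedModType R}
    (M : manifold E) (f : M -> M) : Prop :=
  smooth_map f /\ exists h, [/\ cancel f h, cancel h f & smooth_map h].

Section LieGroupBundle.
Context {R : realType} {n m : nat} (Lam : manifold 'rV[R]_n).

Let Etot : normedModType R := ('rV[R]_n * 'rV[R]_m)%type.

(* A chart psi of the total space in which the projection s is the first
   projection (over the chart phi of the base). For lam in the domain of phi,
   a |-> cinv psi (phi lam, a) parametrizes an open piece of the fiber over
   lam: these are the charts of the submanifold s^-1(lam). *)
Definition adapted (G : manifold Etot) (s : G -> Lam)
    (phi : chart Lam 'rV[R]_n) (psi : chart G Etot) : Prop :=
  [/\ atlas phi, atlas psi &
      forall g, cdom psi g -> cdom phi (s g) /\ (psi g).1 = phi (s g)].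

(* [mul g h] is meaningful when g and h lie over the same point. Its smoothness
   on the fiber product is expressed in the charts (u, a, b) of the fiber
   product given by two adapted charts. *)
Record lie_bundle := LieBundle {
  lb_total :> manifold Etot;
  src : lb_total -> Lam;
  one : Lam -> lb_total;
  mul : lb_total -> lb_total -> lb_total;
  inv : lb_total -> lb_total;
  lb_second_countable : @second_countable lb_total;
  src_submersion : submersion src;
  src_one : forall l, src (one l) = l;
  src_mul : forall g h, src g = src h -> src (mul g h) = src g;
  src_inv : forall g, src (inv g) = src g;
  lb_mulA : forall g h k, src g = src h -> src h = src k ->
    mul g (mul h k) = mul (mul g h) k;
  lb_mul1 : forall g, mul (one (src g)) g = g /\ mul g (one (src g)) = g;
  lb_mulV : forall g,
    mul (inv g) g = one (src g) /\ mul g (inv g) = one (src g);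
  one_smooth : smooth_map one;
  inv_smooth : smooth_map inv;
  mul_continuous : {within [set p : lb_total * lb_total | src p.1 = src p.2],
    continuous (fun p : lb_total * lb_total => mul p.1 p.2)};
  mul_smooth : forall phi psi1 psi2 psi3,
    adapted src phi psi1 -> adapted src phi psi2 -> atlas psi3 ->
    let mul_loc (p : Etot * 'rV[R]_m) :=
      mul (cinv psi1 p.1) (cinv psi2 (p.1.1, p.2)) in
    smooth [set p | [/\ ccod psi1 p.1, ccod psi2 (p.1.1, p.2) &
                        cdom psi3 (mul_loc p)]]
           (psi3 \o mul_loc) }.

Context (G : lie_bundle) {E : normedModType R} (X : manifold E).
Implicit Types (act : G -> X -> X) (l : Lam) (x : X).

Definition is_action act : Prop :=
  [/\ forall l x, act (one G l) x = x,
      forall g h x, src g = src h -> act (mul g h) x = act g (act h x),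
      forall g, diffeomorphism (act g) &
      continuous (fun p : G * X => act p.1 p.2)].

(* the orbit map g |-> g.x of the fiber over l, read in charts *)
Definition orbit_loc act (phi : chart Lam 'rV[R]_n) (psi : chart G Etot)
    (c : chart X E) l x : 'rV[R]_m -> E :=
  fun a => c (act (cinv psi (phi l, a)) x).

(* coordinates of the unit over l in the corresponding chart of the fiber *)
Definition one_loc (psi : chart G Etot) l : 'rV[R]_m := (psi (one G l)).2.

Definition regular act : Prop :=
  forall phi psi (c : chart X E), adapted (@src G) phi psi -> atlas c ->
  forall l x, cdom psi (one G l) -> cdom c x ->
    differentiable (orbit_loc act phi psi c l x) (one_loc psi l) /\
    {for (l, x), continuous (fun p : Lam * X =>
      dBL (orbit_loc act phi psi c p.1 p.2) (one_loc psi p.1))}.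

(* the image of the differential at the unit of the orbit map; it does not
   depend on the adapted chart *)
Definition orbit_tangent act l x : set (tangent x) :=
  [set w | exists phi psi,
    [/\ adapted (@src G) phi psi, cdom psi (one G l) &
        exists a,
          'd (orbit_loc act phi psi (chart_at x) l x) (one_loc psi l) a = w]].

Arguments orbit_tangent act l x _ : clear implicits.

Definition equivariantly_nondegenerate act (f : Lam -> X -> R) l x : Prop :=
  critical (f l) x /\
  [set v : tangent x | forall w, hessian (f l) x v w = 0] = orbit_tangent act l x.

End LieGroupBundle.

Section BanachBundle.
Context {R : realType} {E : normedModType R}.

Record trivialization (X : manifold E) (fib : X -> completeNormedModType R)
    (W : completeNormedModType R) := Trivialization {
  tbase : set X;
  tmap :> forall x, fib x -> W;
  tinv : forall x, W -> fib x;
  tbase_open : open tbase;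
  tmap_linear : forall x, tbase x -> linear (@tmap x);
  tmapK : forall x, tbase x -> cancel (@tmap x) (@tinv x);
  tinvK : forall x, tbase x -> cancel (@tinv x) (@tmap x);
  tmap_continuous : forall x, tbase x -> continuous (@tmap x);
  tinv_continuous : forall x, tbase x -> continuous (@tinv x) }.

Arguments tmap {X fib W} t x _.
Arguments tinv {X fib W} t x _.

Record banach_bundle (X : manifold E) (W : completeNormedModType R) :=
    BanachBundle {
  fiber :> X -> completeNormedModType R;
  trivs : set (trivialization fiber W);
  trivs_cover : forall x, exists2 t, trivs t & tbase t x;
  trivs_smooth : forall t u (c : chart X E), trivs t -> trivs u -> atlas c ->
    smooth (c @` (cdom c `&` (tbase t `&` tbase u)))
      (fun y => toBL (fun w => u (cinv c y) (tinv t (cinv c y) w))) }.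

Context (X : manifold E) (W : completeNormedModType R)
  (B : banach_bundle X W).

(* fiberwise injective linear maps T_xX -> B_x such that the map of total
   spaces TX -> B is continuous *)
Definition tangent_inclusion (incl : forall x : X, tangent x -> B x) : Prop :=
  [/\ forall x, linear (incl x), forall x, injective (incl x) &
      forall t (c : chart X E), trivs t -> atlas c ->
      forall x v, cdom c x -> tbase t x ->
        {for (x, v), continuous
          (fun p : X * E => t p.1 (incl p.1 (tvec c p.1 p.2)))}].

Definition inner_product (x : X) (ip : B x -> B x -> R) : Prop :=
  [/\ is_bilinear ip, forall e e', ip e e' = ip e' e &
      forall e, e != 0 -> 0 < ip e e].

(* the bundle map e |-> <e, .>_x from B to the dual of TX, the fibers of the
   latter carrying the dual norm, is of class C^k as a map of total spaces *)
Definition dual_morphism (k : nat) (incl : forall x : X, tangent x -> B x)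
    (ip : forall x, B x -> B x -> R) : Prop :=
  (forall x (e : B x),
    continuous (fun v : tangent x => ip x e (incl x v) : R^o)) /\
  forall t (c : chart X E), trivs t -> atlas c ->
    Ck k ((c @` (cdom c `&` tbase t)) `*` [set: W])
      (fun p : E * W => let x := cinv c p.1 in
        toBL (fun v : E => ip x (tinv t x p.2) (incl x (tvec c x v)) : R^o)).

Context {F : normedModType R} (Lam : manifold F).

Definition Ck_sections (k : nat) (delta : Lam -> forall x, B x) : Prop :=
  forall (phi : chart Lam F) (c : chart X E) t,
    atlas phi -> atlas c -> trivs t ->
    Ck k (ccod phi `*` (c @` (cdom c `&` tbase t)))
      (fun p : F * E => let x := cinv c p.2 in t x (delta (cinv phi p.1) x)).

(* At a zero x of the section sigma, the vertical projection of the
   differential of sigma is its derivative in any trivialization around x. *)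
Definition vertical_derivative (sigma : forall x, B x) (x : X)
    (J : tangent x -> B x) : Prop :=
  sigma x = 0 /\
  forall t, trivs t -> tbase t x -> forall v,
    t x (J v) =
    'd (fun y => t _ (sigma (cinv (chart_at x) y))) (chart_at x x) v.

End BanachBundle.

Definition fredholm_structure {R : realType} {E F : normedModType R}
    (Lam : manifold F) (X : manifold E) (f : Lam -> X -> R)
    (l0 : Lam) (x0 : X) : Prop :=
  exists (W : completeNormedModType R) (B : banach_bundle X W)
         (incl : forall x : X, tangent x -> B x)
         (ip : forall x, B x -> B x -> R) (k : nat)
         (delta : Lam -> forall x, B x) (J : BL (tangent x0) (B x0)),
    ([/\ tangent_inclusion incl,
         forall x, inner_product (ip x),
         (0 < k)%N &
         dual_morphism k incl ip] /\
     [/\ forall l x (v : tangent x),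
           fdiff (f l) x v = ip x (delta l x) (incl x v),
         Ck_sections k delta &
         forall l x, critical (f l) x <-> delta l x = 0]) /\
    [/\ fredholm J 0,
        forall v w, hessian (f l0) x0 v w = ip x0 (J v) (incl x0 w) &
        vertical_derivative (delta l0) J].

(* Main.v *)
Require Import Defs.
From HB Require Import structures.
From mathcomp Require Import all_boot all_order all_algebra.
From mathcomp Require Import lra ring.
From mathcomp Require Import all_classical all_reals all_analysis.

Set Implicit Arguments.
Unset Strict Implicit.
Unset Printing Implicit Defensive.

Import Order.TTheory GRing.Theory Num.Theory.
Import numFieldNormedType.Exports.

Local Open Scope classical_set_scope.
Local Open Scope ring_scope.

(** Near (l0, x0) the critical points of the functionals are cut down to one
per parameter by a slice transverse to the orbit of x0, and every orbit near
x0 is shown to meet that slice. Let D be the tangent space at x0 of the orbit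
of x0; by nondegeneracy it is the kernel of the second variation.

The infinitesimal orbit directions annihilate every differential
([diff_along_orbit]). Differentiating this identity at x0 shows that the
directions in D are also killed when they occupy the second slot of the second
variation ([hessian_orbit]), so that the range of the Fredholm operator J is
orthogonal to the image of D, in particular to that of ker J, in the fiber of
the bundle. Since J has index 0, the image of ker J is then a complement of
the range of J. Hence, for a basis b of ker J and q_i(v) = <b_i, v>, the
operator L v = J v + sum_i q_i(v) b_i is bijective ([lyapunov_schmidt]), and
boundedly invertible by the open mapping theorem ([bounded_inverse]).

Work in a trivialization of the bundle and let e_i be the image of b_i there.
The augmented gradient Phi(l, y) = delta_l(y) + sum_i q_i(y - y0) e_i has
partial derivative L at (l0, y0), so the implicit function theorem
([implicit_zero_unique], [implicit_zero_exists]) gives a unique zero y_l near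
y0 for each l near l0; the corresponding point is x_l. Near (l0, x0) the zeros
of Phi are exactly the critical points on the slice q(y - y0) = 0: pairing the
equation Phi = 0 with the orbit directions eliminates the gradient and leaves
a square linear system for the q_i(y - y0), whose matrix is close to the Gram
matrix of b ([multipliers_vanish]).

It remains to move a critical point x near x0 into the slice, that is, to
solve q(g x - y0) = 0 for g near the unit ([orbit_meets_slice]). The action is
only assumed to be continuous, with orbit maps differentiable at the unit, but
the group law transports this information: near a group element g0, the orbit
map of x is the orbit map of g0 x precomposed with right translation by the
inverse of g0, which is smooth. Therefore the orbit maps are differentiable
near the unit, with a differential depending continuously on all data
([orbit_loc_diff], [orbit_strict_diff]), and the same implicit function
theorem applies. The moved point g x is critical by invariance, so it is x_l
and x lies in the orbit of x_l. *)

(** * Linear functions, sums and determinants *)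

(** Matrix spaces inherit completeness from the reals; together with their
norm this makes them complete normed modules. *)
HB.instance Definition _ (R : realType) (m n : nat) :=
  Uniform_isComplete.Build 'M[R]_(m, n) cauchy_cvg.

Section LinearFunctions.
Context {R : realType} {E W : lmodType R} (L : E -> W).
Hypothesis lL : linear L.

Lemma lin0 : L 0 = 0.
Proof. by have := lL (-1) 0 0; rewrite scaler0 addr0 scaleN1r addNr. Qed.

Lemma linZ c v : L (c *: v) = c *: L v.
Proof. by have := lL c v 0; rewrite addr0 lin0 addr0. Qed.

Lemma linD u v : L (u + v) = L u + L v.
Proof. by have := lL 1 u v; rewrite !scale1r. Qed.

Lemma linN v : L (- v) = - L v.
Proof. by rewrite -scaleN1r linZ scaleN1r. Qed.

Lemma linB u v : L (u - v) = L u - L v.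
Proof. by rewrite linD linN. Qed.

Lemma lin_sum (I : Type) (r : seq I) (F : I -> E) :
  L (\sum_(i <- r) F i) = \sum_(i <- r) L (F i).
Proof. by apply: (big_morph L linD lin0). Qed.

End LinearFunctions.

Section Continuity.
Context {R : realType} {T : Type} (F : set_system T) {FF : Filter F}.

Lemma cvg_sum_ord {V : normedModType R} {I : Type} (r : seq I)
    (f : I -> T -> V) (a : I -> V) :
  (forall i, f i x @[x --> F] --> a i) ->
  \sum_(i <- r) f i x @[x --> F] --> \sum_(i <- r) a i.
Proof.
move=> fa; elim: r => [|i r' IH].
  by under eq_cvg do rewrite big_nil; rewrite big_nil; exact: cvg_cst.
by under eq_cvg do rewrite big_cons; rewrite big_cons; exact: cvgD.
Qed.

Lemma cvg_prod_ord {I : Type} (r : seq I) (f : I -> T -> R) (a : I -> R) :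
  (forall i, f i x @[x --> F] --> a i) ->
  \prod_(i <- r) f i x @[x --> F] --> \prod_(i <- r) a i.
Proof.
move=> fa; elim: r => [|i r' IH].
  by under eq_cvg do rewrite big_nil; rewrite big_nil; exact: cvg_cst.
by under eq_cvg do rewrite big_cons; rewrite big_cons; exact: cvgM.
Qed.

Lemma cvg_det k (M : T -> 'M[R]_k) (M0 : 'M[R]_k) :
  (forall i j, M x i j @[x --> F] --> M0 i j) -> \det (M x) @[x --> F] --> \det M0.
Proof.
move=> MM0; apply: cvg_sum_ord => s; apply: cvgM; first exact: cvg_cst.
exact: cvg_prod_ord.
Qed.

(** Invertibility is the open condition that the determinant be nonzero. *)
Lemma unitmx_near k (M : T -> 'M[R]_k) (M0 : 'M[R]_k) :
  (forall i j, M x i j @[x --> F] --> M0 i j) -> M0 \in unitmx ->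
  \forall x \near F, M x \in unitmx.
Proof.
move=> /cvg_det cM; rewrite unitmxE unitfE => M00.
have N0 : nbhs (\det M0) [set x : R | x != 0].
  by apply: open_nbhs_nbhs; split; [exact: open_neq|].
have H : \forall x \near F, \det (M x) != 0 by exact: (cM _ N0).
by apply: filterS H => x; rewrite unitmxE unitfE.
Qed.

Lemma cvg_row k (v : T -> 'rV[R]_k) (v0 : 'rV[R]_k) :
  (forall i, v x ord0 i @[x --> F] --> v0 ord0 i) -> v x @[x --> F] --> v0.
Proof.
move=> vv0.
have -> : v = (fun x => \sum_j v x ord0 j *: delta_mx ord0 j).
  by apply/funext => x; exact: row_sum_delta.
rewrite {1}[v0]row_sum_delta; apply: cvg_sum_ord => i; exact: cvgZr_tmp.
Qed.

End Continuity.

Section FiniteCombinations.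
Context {R : realType} {V : normedModType R} (k : nat) (v : 'I_k -> V).

Lemma comb_linear : linear (fun s : 'rV[R]_k => \sum_i s ord0 i *: v i).
Proof.
move=> a s s'; rewrite scaler_sumr -big_split/=; apply: eq_bigr => i _.
by rewrite !mxE scalerDl scalerA.
Qed.

Lemma comb_continuous : continuous (fun s : 'rV[R]_k => \sum_i s ord0 i *: v i).
Proof.
move=> s; apply: (cvg_sum_ord (F := nbhs s)) => i.
by apply: cvgZr_tmp; exact: coord_continuous.
Qed.

End FiniteCombinations.

(** * Fréchet differentials *)

Section DiffNear.
Context {R : realType} {E W : normedModType R}.

Lemma diff_near (f : E -> W) (y : E) :
  differentiable f y -> forall e, 0 < e ->
  \forall h \near 0, `|f (h + y) - f y - 'd f y h| <= e * `|h|.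
Proof.
move=> df e e0; have /diff_locallyx H := df.
near=> h; rewrite H -addrA -opprD addrC addKr.
by near: h; apply: littleoP.
Unshelve. all: by end_near. Qed.

(** The characterization of the differential by an explicit first order
estimate avoids handling little-o terms in what follows. *)
Lemma diff_of_estimate (f : E -> W) (x : E) (df : {linear E -> W}) :
  continuous df ->
  (forall e : R, 0 < e -> \forall h \near 0, `|f (h + x) - f x - df h| <= e * `|h|) ->
  differentiable f x /\ 'd f x = df :> (E -> W).
Proof.
move=> cdf H.
have fE : f \o shift x = cst (f x) + df +o_ 0 id.
  apply/eqaddoP => e e0; have := H e e0; apply: filterS => h.
  by rewrite opprD addrA.
have dfE : 'd f x = df :> (E -> W) by exact: diff_unique.
by split => //; apply/diff_locallyP; rewrite dfE.
Qed.

Lemma diff_near_eq (f g : E -> W) (x : E) :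
  (\forall y \near x, f y = g y) -> differentiable g x ->
  differentiable f x /\ 'd f x = 'd g x :> (E -> W).
Proof.
move=> fg dg; apply: diff_of_estimate; first exact: diff_continuous.
move=> e e0; have Hg := diff_near dg e0.
have ch : h + x @[h --> (0 : E)] --> x.
  have : h + x @[h --> (0 : E)] --> 0 + x by apply: cvgD; [exact: cvg_id|exact: cvg_cst].
  by rewrite add0r.
near=> h; rewrite (nbhs_singleton fg).
have -> : f (h + x) = g (h + x) by near: h; exact: (ch _ fg).
by near: h.
Unshelve. all: by end_near. Qed.

End DiffNear.

Section DiffRules.
Context {R : realType}.

Lemma lin_diff (E W : normedModType R) (f : E -> W) (x : E) :
  linear f -> continuous f -> differentiable f x /\ 'd f x = f :> (E -> W).
Proof.
move=> lf cf; pose fL : {linear E -> W} := HB.pack f (GRing.isLinear.Build _ _ _ _ _ lf).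
split; first exact: (@linear_differentiable _ _ _ fL).
exact: (@diff_lin _ _ _ fL).
Qed.

Lemma diff_chain (E W V : normedModType R) (f : E -> W) (g : W -> V) x :
  differentiable f x -> differentiable g (f x) ->
  differentiable (g \o f) x /\ forall v, 'd (g \o f) x v = 'd g (f x) ('d f x v).
Proof.
move=> df dg; split; first exact: differentiable_comp.
by move=> v; rewrite diff_comp.
Qed.

Lemma diff_pair_l (E W : normedModType R) (b : W) (x : E) :
  differentiable (fun y : E => (y, b)) x /\
  forall v, 'd (fun y : E => (y, b)) x v = (v, 0).
Proof.
have [d1 d1E] := @lin_diff E E id x (fun _ _ _ => erefl) (fun _ => cvg_id).
split; first by apply: differentiable_pair => //; exact: differentiable_cst.
by move=> v; rewrite diff_pair ?d1E ?diff_cst//; exact: differentiable_cst.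
Qed.

Lemma diff_pair_r (E W : normedModType R) (b : W) (x : E) :
  differentiable (fun y : E => (b, y)) x /\
  forall v, 'd (fun y : E => (b, y)) x v = (0, v).
Proof.
have [d1 d1E] := @lin_diff E E id x (fun _ _ _ => erefl) (fun _ => cvg_id).
split; first by apply: differentiable_pair => //; exact: differentiable_cst.
by move=> v; rewrite diff_pair ?d1E ?diff_cst//; exact: differentiable_cst.
Qed.

Lemma diff_snd (E W : normedModType R) (x : E * W) :
  differentiable (snd : E * W -> W) x /\ forall v, 'd (snd : E * W -> W) x v = v.2.
Proof.
have [] := @lin_diff (E * W)%type W snd x; [by []|move=> y; exact: cvg_snd|].
by move=> d ->.
Qed.

Lemma diff_chain_at (E W V : normedModType R) (f : E -> W)
    (g : W -> V) x y : f x = y ->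
  differentiable f x -> differentiable g y ->
  differentiable (g \o f) x /\ forall v, 'd (g \o f) x v = 'd g y ('d f x v).
Proof. by move=> <-; exact: diff_chain. Qed.

End DiffRules.

Section AffineMaps.
Context {R : realType} {E W : normedModType R} (L : E -> W).
Hypotheses (lL : linear L) (cL : continuous L).

Lemma affine_diff (w : W) (x : E) :
  differentiable (fun y => L y + w) x /\ forall v, 'd (fun y => L y + w) x v = L v.
Proof.
have [dL dLE] := lin_diff x lL cL.
have dc := differentiable_cst w x.
split; first exact: (differentiableD dL dc).
move=> v; apply: (etrans (congr1 (fun F => F v) (diffD dL dc))) => /=.
have dc0 : 'd (cst w) x v = 0 := congr1 (fun F => F v) (diff_cst w x).
exact: (etrans (congr2 +%R (congr1 (fun F => F v) dLE) dc0) (addr0 _)).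
Qed.

Lemma lin_lipschitz : exists2 k : R, 0 < k & forall v, `|L v| <= k * `|v|.
Proof.
pose LL : {linear E -> W} := HB.pack L (GRing.isLinear.Build _ _ _ _ _ lL).
exact: (@linear_lipschitz _ _ _ LL).
Qed.

End AffineMaps.

Section BoundedLinearMaps.
Context {R : realType} {U V : normedModType R}.

(** The junk value of [toBL] is not taken. *)
Lemma toBLE (f : U -> V) : linear f -> continuous f -> bl_fun (toBL f) = f.
Proof.
move=> lf cf; have fP : f \in @bl_pred R U V by apply/asboolP.
exact: (@xgetPex _ (0 : BL U V) [set L : BL U V | bl_fun L = f]
  (ex_intro _ (MkBL fP) erefl)).
Qed.

Lemma dBLE (f : U -> V) x : differentiable f x -> dBL f x = 'd f x :> (U -> V).
Proof.
move=> df; apply: toBLE; first by move=> a u v; rewrite linearP.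
exact: diff_continuous.
Qed.

Lemma bl_norm_le (f : BL U V) v : `|f v| <= `|f| * `|v|.
Proof.
have [->|v0] := eqVneq v 0; first by rewrite bl0 !normr0 mulr0.
have v_gt0 : 0 < `|v| by rewrite normr_gt0.
rewrite -ler_pdivrMr// mulrC -{1}(ger0_norm (ltW v_gt0)) -normfV -normrZ -blZ.
by apply: opnorm_ub; rewrite normrZ normfV normr_id mulVf// gt_eqF.
Qed.

Lemma Ck_differentiable k (A : set U) (f : U -> V) x :
  Ck k.+1 A f -> A x -> differentiable f x.
Proof. by move=> [df _] Ax; exact: df. Qed.

Lemma Ck_dBL_continuous k (A : set U) (f : U -> V) x :
  Ck k.+1 A f -> A x -> {for x, continuous (dBL f)}.
Proof.
case: k => [|k] [_ Cdf] Ax; first exact: Cdf.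
by apply: differentiable_continuous; apply: Cdf.1.
Qed.

End BoundedLinearMaps.

Lemma smooth_differentiable {R : realType} {U V : normedModType R} (A : set U)
  (f : U -> V) x : smooth A f -> A x -> differentiable f x.
Proof. by move=> /(_ 1%N)[df _]; exact: df. Qed.

Lemma cvg_bl_apply {R : realType} {U V : normedModType R} {T : Type}
    (F : set_system T) {FF : Filter F} (A : T -> BL U V) (v : T -> U)
    (A0 : BL U V) (v0 : U) :
  A x @[x --> F] --> A0 -> v x @[x --> F] --> v0 -> A x (v x) @[x --> F] --> A0 v0.
Proof.
move=> cA cv.
have cA0 : A0 (v x) @[x --> F] --> A0 v0.
  by apply: continuous_cvg cv; exact: bl_continuous.
suff : (A x - A0) (v x) + A0 (v x) @[x --> F] --> 0 + A0 v0.
  rewrite add0r; apply: cvg_trans; apply: near_eq_cvg; apply: nearW => x.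
  by rewrite -bl_addE subrK.
apply: cvgD cA0; apply/norm_cvg0P.
have : `|A x - A0| * `|v x| @[x --> F] --> `|A0 - A0| * `|v0|.
  by apply: cvgM; apply: cvg_norm => //; apply: cvgB => //; exact: cvg_cst.
rewrite subrr normr0 mul0r => c0.
apply: (squeeze_cvgr _ (cvg_cst 0) c0); apply: nearW => x.
by rewrite normr_ge0 bl_norm_le.
Qed.

(** Operator-norm continuity of a composition A (s (B (i v))) of two varying
operators with two fixed contractions between them. *)
Lemma bl_comp_near {R : realType} {P Q U V S : normedModType R} {T : Type}
    (F : set_system T) {FF : Filter F} (A : T -> BL U V) (A0 : BL U V)
    (B : T -> BL P Q) (B0 : BL P Q) (s : Q -> U) (i : S -> P) :
  {morph s : u v / u - v} -> (forall w, `|s w| <= `|w|) -> (forall v, `|i v| <= `|v|) ->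
  A x @[x --> F] --> A0 -> B x @[x --> F] --> B0 ->
  forall e : R, 0 < e -> \forall x \near F, forall v,
    `|A x (s (B x (i v))) - A0 (s (B0 (i v)))| <= e * `|v|.
Proof.
move=> sB s1 i1 cA cB e e0.
pose k := `|A0| + `|B0| + 1; have k0 : 0 < k by rewrite ltr_wpDl// addr_ge0.
pose d := Num.min 1 (e / k).
have d0 : 0 < d by rewrite lt_min ltr01 divr_gt0.
have /cvgrPdist_le/(_ d d0) HA := cA; have /cvgrPdist_le/(_ d d0) HB := cB.
near=> x => v.
have Ax : `|A x - A0| <= d by rewrite distrC; near: x.
have Bx : `|B x - B0| <= d by rewrite distrC; near: x.
have dk : d * k <= e by rewrite -ler_pdivlMr// ge_min lexx orbT.
have d1 : d <= 1 by rewrite ge_min lexx.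
set w := B x (i v); set w0 := B0 (i v).
have ww0 : `|w - w0| <= d * `|v|.
  rewrite (le_trans (bl_norm_le (B x - B0) (i v)))//.
  by rewrite ler_pM// (le_trans _ (s1 0)).
have w_le : `|w| <= (d + `|B0|) * `|v|.
  rewrite -(subrK w0 w) (le_trans (ler_normD _ _))// mulrDl lerD//.
  by rewrite (le_trans (bl_norm_le _ _))// ler_wpM2l.
have -> : A x (s w) - A0 (s w0) = (A x - A0) (s w) + A0 (s (w - w0)).
  rewrite sB (linB (@bl_linear _ _ _ A0)).
  rewrite -[X in X - _](subrK (A0 (s w))) -addrA; congr (_ + _).
apply: (le_trans (ler_normD _ _)).
have H1 : `|(A x - A0) (s w)| <= d * ((d + `|B0|) * `|v|).
  rewrite (le_trans (bl_norm_le _ _))// ler_pM// (le_trans (s1 _))//.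
have H2 : `|A0 (s (w - w0))| <= `|A0| * (d * `|v|).
  by rewrite (le_trans (bl_norm_le _ _))// ler_wpM2l// (le_trans (s1 _)).
apply: (le_trans (lerD H1 H2)).
apply: (@le_trans _ _ (d * k * `|v|)); last by rewrite ler_wpM2r.
rewrite mulrA mulrA -mulrDl ler_wpM2r// (mulrC `|A0|) -mulrDr ler_pM2l// /k.
by lra.
Unshelve. all: by end_near. Qed.

Lemma norm_sub_congr {R : realType} {V : normedModType R} (a b a' b' : V) (k : R) :
  a = a' -> b = b' -> `|a' - b'| <= k -> `|a - b| <= k.
Proof. by move=> -> ->. Qed.

Lemma norm_sub_addr {R : realType} {V : normedModType R} (a b q : V) (k : R) :
  `|b - a| <= k -> `|(a + q) - (b + q)| <= k.
Proof. by rewrite opprD addrACA subrr addr0 distrC. Qed.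

(** * Mean value inequality and implicit function theorem *)

Section MeanValue.
Context {R : realType}.

(** The set of times s at which the increment from 0 is at most (M + e) s
contains its supremum and, if that supremum were smaller than 1, also a later
time: both follow from the local estimate at the supremum. *)
Lemma path_mean_value (W : normedModType R) (g : R -> W) (M : R) :
  0 <= M ->
  (forall s : R, 0 <= s <= 1 -> forall e : R, 0 < e ->
    \forall t \near s, `|g t - g s| <= (M + e) * `|t - s|) ->
  `|g 1 - g 0| <= M.
Proof.
move=> M0 H; apply/ler_addgt0Pr => e e0.
have Me0 : 0 <= M + e by rewrite addr_ge0// ltW.
pose A := [set s : R | 0 <= s <= 1 /\ `|g s - g 0| <= (M + e) * s].
have A0 : A 0 by split; rewrite ?lexx ?ler01// subrr normr0 mulr0.
have hsA : has_sup A.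
  by split; [exists 0|exists 1 => s [/andP[]]].
set s := sup A.
have s0 : 0 <= s by apply: sup_upper_bound.
have s1 : s <= 1 by apply: ge_sup; [exists 0|move=> t [/andP[]]].
have s01 : 0 <= s <= 1 by rewrite s0.
have /nbhs_normP[d /= d0 Hd] := H _ s01 _ e0.
have As : A s.
  split => //.
  have [t At ts] := sup_adherent d0 hsA.
  have tles : t <= s by apply: sup_upper_bound.
  have /= := Hd t; rewrite /ball_ /= ger0_norm ?subr_ge0// ltrBlDl -ltrBlDr.
  move=> /(_ ts); rewrite distrC (distrC t) (ger0_norm (x := s - t)) ?subr_ge0// => Ht.
  rewrite -(subrKA (g t)) (le_trans (ler_normD _ _))//.
  rewrite -[X in _ * X](subrK t) mulrDr lerD//; exact: At.2.
(* If s < 1, the estimate at s extends A to the right of s. *)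
suff se1 : s = 1 by move: As => [_]; rewrite se1 mulr1.
apply/eqP; rewrite eq_le s1 /= leNgt; apply/negP => s_lt1.
pose t := Num.min 1 (s + d / 2).
have st : s < t by rewrite lt_min s_lt1 ltrDl divr_gt0.
have t1 : t <= 1 by rewrite ge_min lexx.
suff /(sup_upper_bound hsA) : A t by rewrite leNgt st.
split; first by rewrite t1 (le_trans s0)// ltW.
have /= := Hd t; rewrite /ball_ /= distrC gtr0_norm ?subr_gt0//.
have -> : t - s < d.
  by rewrite ltrBlDl gt_min ltrD2l ltr_pdivrMr// ltr_pMr// ltr1n orbT.
move=> /(_ isT) Ht; rewrite -(subrKA (g s)) (le_trans (ler_normD _ _))//.
rewrite -[X in _ * X](subrK s) mulrDr lerD//; exact: As.2.
Qed.

(** The mean value inequality along the segment from a to b, applied to f - L.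
It compares a C^1 map with its linearization at a nearby point. *)
Lemma mean_value (E W : normedModType R) (f L : E -> W) (a b : E) (M : R) :
  linear L -> 0 <= M ->
  (forall s : R, 0 <= s <= 1 -> differentiable f (a + s *: (b - a)) /\
    forall v, `|'d f (a + s *: (b - a)) v - L v| <= M * `|v|) ->
  `|f b - f a - L (b - a)| <= M * `|b - a|.
Proof.
move=> lL M0 H.
pose g (s : R) := f (a + s *: (b - a)) - s *: L (b - a).
have -> : f b - f a - L (b - a) = g 1 - g 0.
  by rewrite /g !scale1r !scale0r subr0 addr0 addrC (addrC a) subrK addrC addrAC.
apply: path_mean_value; first by rewrite mulr_ge0.
move=> s s01 e e0; have [df dL] := H _ s01.
have k0 : 0 < e / (1 + `|b - a|) by rewrite divr_gt0// ltr_pwDl.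
have Hn := diff_near df k0.
have ch : h *: (b - a) @[h --> (0:R)] --> (0 : E).
  by rewrite -[X in _ --> X](scale0r (b - a)); exact: scalel_continuous.
have ct : t - s @[t --> s] --> (0 : R).
  by rewrite -[X in _ --> X](subrr s); apply: (cvgB (f := id) (g := cst s)); [exact: cvg_id|exact: cvg_cst].
have : \forall t \near s, `|f ((t - s) *: (b - a) + (a + s *: (b - a))) -
    f (a + s *: (b - a)) - 'd f (a + s *: (b - a)) ((t - s) *: (b - a))| <=
    e / (1 + `|b - a|) * `|(t - s) *: (b - a)|.
  exact: (ct _ (ch _ Hn)).
apply: filterS => t.
set h := (t - s) *: (b - a).
have -> : h + (a + s *: (b - a)) = a + t *: (b - a).
  by rewrite addrCA -scalerDl subrK.
move=> Ht.
have -> : g t - g s = (f (a + t *: (b - a)) - f (a + s *: (b - a))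
     - 'd f (a + s *: (b - a)) h) + ('d f (a + s *: (b - a)) h - L h).
  rewrite addrA subrK /g opprD opprK addrACA; congr (_ + _).
  by rewrite (linZ lL) scalerBl opprB addrC.
rewrite (le_trans (ler_normD _ _))// mulrDl [leRHS]addrC lerD//.
  rewrite (le_trans Ht)// normrZ mulrCA mulrC ler_wpM2r//.
  rewrite -mulrA ger_pMr// mulrC ler_pdivrMr ?ltr_pwDl// mul1r lerDr//.
by rewrite (le_trans (dL _))// normrZ -mulrA ler_wpM2l// mulrC.
Qed.

End MeanValue.

Section ImplicitFunction.
Context {R : realType}.
Variables (P : topologicalType) (E : completeNormedModType R)
  (W : normedModType R) (Phi : P -> E -> W) (L : E -> W) (K : W -> E) (C : R)
  (p0 : P) (y0 : E).
Hypotheses (lL : linear L) (KL : cancel K L) (C0 : 0 < C)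
  (LC : forall v, `|v| <= C * `|L v|).
Hypothesis dPhi : forall e : R, 0 < e -> \forall q \near (p0, y0),
  differentiable (Phi q.1) (q.2) /\
  forall v, `|'d (Phi q.1) (q.2) v - L v| <= e * `|v|.

(** The bound 1/(2C) on the distance between the partial differential and L is
half of what destroys invertibility, so y - K (Phi p y) becomes a contraction
of ratio 1/2. *)
Let close_to_L : exists2 r, 0 < r & \forall p \near p0, forall y y',
  `|y0 - y| < r -> `|y0 - y'| < r ->
  C * `|Phi p y' - Phi p y - L (y' - y)| <= 2^-1 * `|y' - y|.
Proof.
have e0 : 0 < (2 * C)^-1 by rewrite invr_gt0 mulr_gt0.
have [[A B] /= [Ap /nbhs_normP[r /= r0 Br]] AB] := dPhi e0.
exists r => //; apply: filterS Ap => p Ap y y' yr y'r.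
have : `|Phi p y' - Phi p y - L (y' - y)| <= (2 * C)^-1 * `|y' - y|.
  apply: mean_value => //; first exact: ltW.
  move=> s /andP[s0 s1]; apply: (AB (p, y + s *: (y' - y))); split => //=.
  apply: Br => /=.
  (* Balls are convex. *)
  have -> : y0 - (y + s *: (y' - y)) = (1 - s) *: (y0 - y) + s *: (y0 - y').
    rewrite scalerBl scale1r -addrA [- _ + _]addrC -scalerBr opprB.
    by rewrite [_ + (y - y0)]addrC addrA subrK opprD addrA -scalerN opprB.
  rewrite (le_lt_trans (ler_normD _ _))// !normrZ.
  rewrite (ger0_norm s0) ger0_norm ?subr_ge0//.
  have [s1'|s1'] := ltP s 1.
    rewrite -[ltRHS]mul1r -[X in _ < X * _](subrK s) [ltRHS]mulrDl ltr_leD//.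
      by rewrite ltr_pM2l// subr_gt0.
    by rewrite ler_wpM2l// ltW.
  have -> : s = 1 by apply/eqP; rewrite eq_le s1.
  by rewrite subrr mul0r add0r mul1r.
move=> /(ler_wpM2l (ltW C0)) /le_trans; apply.
by rewrite invfM mulrA mulrCA divff ?gt_eqF// mulr1.
Qed.

Lemma implicit_zero_unique : exists2 r, 0 < r & \forall p \near p0,
  forall y y', `|y0 - y| < r -> `|y0 - y'| < r ->
    Phi p y = 0 -> Phi p y' = 0 -> y = y'.
Proof.
have [r r0 H] := close_to_L; exists r => //.
apply: filterS H => p H y y' yr y'r Py Py'.
apply/esym/subr0_eq/eqP; rewrite -normr_le0.
have := H y y' yr y'r; rewrite Py Py' subrr sub0r normrN => /(le_trans (LC _)).
by lra.
Qed.

(** A zero is a fixed point of the Newton-type map y - K (Phi p y) with frozen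
linearization, which preserves a small closed ball as soon as Phi p y0 is
small. *)
Lemma implicit_zero_exists : {for p0, continuous (Phi^~ y0)} -> Phi p0 y0 = 0 ->
  forall e, 0 < e -> \forall p \near p0, exists2 y, `|y0 - y| < e & Phi p y = 0.
Proof.
move=> cPhi Phi0 e e0; have [r r0 H] := close_to_L.
pose d := Num.min e r / 2.
have d0 : 0 < d by rewrite divr_gt0// lt_min e0.
have dlt : d < Num.min e r.
  by rewrite ltr_pdivrMr// ltr_pMr ?lt_min ?e0// ltr1n.
move: dlt; rewrite lt_min => /andP[de dr].
have small : \forall p \near p0, C * `|Phi p y0| <= d / 2.
  have cd0 : 0 < d / (2 * C) by rewrite divr_gt0// mulr_gt0.
  move/cvgrPdist_le : cPhi => /(_ _ cd0); apply: filterS => p.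
  rewrite Phi0 sub0r normrN => /(ler_wpM2l (ltW C0)) /le_trans; apply.
  by rewrite le_eqVlt; apply/orP; left; apply/eqP; field; rewrite gt_eqF.
near=> p.
have Hp : forall y y', `|y0 - y| < r -> `|y0 - y'| < r ->
  C * `|Phi p y' - Phi p y - L (y' - y)| <= 2^-1 * `|y' - y| by near: p.
have Sp : C * `|Phi p y0| <= d / 2 by near: p.
(* The two bounds d / 2, on the motion of the center and on the contracted
radius, keep the closed ball of radius d stable. *)
pose T y := y - K (Phi p y).
have KC w : `|K w| <= C * `|w| by rewrite (le_trans (LC _))// KL.
have TT y y' : `|y0 - y| < r -> `|y0 - y'| < r -> `|T y' - T y| <= 2^-1 * `|y' - y|.
  move=> yr y'r; apply: le_trans (Hp y y' yr y'r).
  rewrite (le_trans (LC _)) ?ler_pM2l// /T.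
  have -> : y' - K (Phi p y') - (y - K (Phi p y)) =
      y' - y - (K (Phi p y') - K (Phi p y)).
    by rewrite opprB (addrC (K _)) addrACA; congr (_ + _); rewrite opprB addrC.
  by rewrite (linB lL) (linB lL (K _)) !KL distrC.
pose B := closed_ball_ Num.norm y0 d.
have TB : set_fun B B T.
  move=> y; rewrite /B /closed_ball_ /= => yd.
  have y0r : `|y0 - y0| < r by rewrite subrr normr0.
  have yr : `|y0 - y| < r by rewrite (le_lt_trans yd).
  rewrite -(subrKA (T y0)) (le_trans (ler_normD _ _))// [leRHS](splitr d) lerD//.
    by rewrite /T opprB addrC subrK (le_trans (KC _)).
  by rewrite (le_trans (TT _ _ _ _))// mulrC ler_pM2r// invr_gt0.
have [y By Ty] : exists2 y, B y & y = T y.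
  pose fT := isFun.Build _ _ _ _ _ TB.
  pose T' : {fun B >-> B} := HB.pack T fT.
  apply: (@banach_fixed_point _ _ _ T').
  - exists (2^-1)%:nng; split => /=; first by rewrite invf_lt1// ltr1n.
    move=> [y y'] [/= By By']; apply: TT; exact: le_lt_trans dr.
  - exact: closed_closed_ball_.
  - by exists y0; rewrite /B /closed_ball_ /= subrr normr0 ltW.
exists y; first exact: le_lt_trans de.
have K0 : K (Phi p y) = 0 by rewrite -(subrr y) [X in _ - X]Ty /T subKr.
by rewrite -(KL (Phi p y)) K0 (lin0 lL).
Unshelve. all: by end_near. Qed.

End ImplicitFunction.

(** * Open mapping theorem *)

Section OpenMapping.
Context {R : realType} {E W : completeNormedModType R} (L : E -> W).
Hypotheses (lL : linear L) (cL : continuous L) (surjL : forall w, exists v, L v = w).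

(** W is the union of the images of the balls of integer radius, so by Baire
one of their closures has interior. *)
Lemma closure_image_ball : exists n w0, exists2 r : R, 0 < r &
  forall w, `|w0 - w| < r -> closure (L @` [set v | `|v| <= n%:R]) w.
Proof.
pose F n : set W := ~` closure (L @` [set v | `|v| <= n%:R]).
have [n /denseNE [D [[w0 Dw0] DF]]] : exists n, ~ dense (F n).
  apply/existsNP => dF.
  have [| | |w [_ Fw]] := @Baire _ _ F _ setT.
  - by move=> n; split; [exact/closed_openC/closed_closure|exact: dF].
  - by exists 0.
  - exact: openT.
  have [v Lv] := surjL w.
  apply: (Fw (Num.truncn `|v|).+1 I); apply: subset_closure; exists v => //=.
  by rewrite ltW// truncnS_gt.
exists n, w0; have /open_nbhs_nbhs/nbhs_normP[r r0 rD] : open_nbhs w0 D by [].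
exists r => // w w0w; apply: contrapT => nw.
by suff : set0 w by []; rewrite -DF; split; [exact: rD|].
Qed.

(** Subtracting approximate preimages of w0 + t w and of w0, where t w is
short enough to stay in the ball of [closure_image_ball], gives an approximate
preimage of t w. *)
Lemma approximate_preimage : exists2 C : R, 0 < C &
  forall w, exists v, `|v| <= C * `|w| /\ `|w - L v| <= 2^-1 * `|w|.
Proof.
have [n [w0 [r r0 H]]] := closure_image_ball.
have pre w : `|w0 - w| < r -> exists2 v, `|v| <= n%:R & `|w - L v| < r / 8.
  have r8 : 0 < r / 8 by rewrite divr_gt0.
  move=> /H /(_ _ (nbhsx_ballx _ _ r8)) [_ [[v vn <-]]].
  by rewrite -ball_normE; exists v.
have [|v0 v0n Lv0] := pre w0; first by rewrite subrr normr0.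
(* The errors r / 8 of the two approximate preimages add up to r / 4, which is
half of the length r / 2 of t w below. *)
exists (4 * (n%:R + 1) / r); first by rewrite divr_gt0// mulr_gt0// ltr_wpDl.
move=> w; have [->|wN0] := eqVneq w 0.
  by exists 0; rewrite (lin0 lL) subrr !normr0 !mulr0 lexx.
have w_gt0 : 0 < `|w| by rewrite normr_gt0.
pose t := r / (2 * `|w|).
have t0 : 0 < t by rewrite divr_gt0// mulr_gt0.
have [|v vn Lv] := pre (w0 + t *: w).
  rewrite opprD addrA subrr sub0r normrN normrZ gtr0_norm// /t.
  have -> : r / (2 * `|w|) * `|w| = r / 2 by field; rewrite normr_eq0.
  by rewrite ltr_pdivrMr// ltr_pMr// ltr1n.
exists (t^-1 *: (v - v0)); split.
  rewrite normrZ gtr0_norm ?invr_gt0//.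
  apply: (@le_trans _ _ (t^-1 * (n%:R + n%:R))).
    by rewrite ler_pM2l ?invr_gt0// (le_trans (ler_normB _ _))// lerD.
  rewrite /t invf_div -subr_ge0.
  have -> : 4 * (n%:R + 1) / r * `|w| - 2 * `|w| / r * (n%:R + n%:R) =
    4 * `|w| / r by field; rewrite gt_eqF.
  by rewrite divr_ge0 ?mulr_ge0// ltW.
have -> : w - L (t^-1 *: (v - v0)) =
    t^-1 *: ((w0 + t *: w - L v) - (w0 - L v0)).
  have -> : w0 + t *: w - L v - (w0 - L v0) = t *: w - (L v - L v0).
    rewrite opprB [w0 + _]addrC [t *: w + w0 - _]addrAC.
    by rewrite [_ - w0]addrC addrA addrK opprB [L v0 - _]addrC addrA.
  by rewrite (linZ lL) (linB lL) [RHS]scalerBr scalerA mulVf ?gt_eqF// scale1r.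
rewrite normrZ gtr0_norm ?invr_gt0//.
apply: (@le_trans _ _ (t^-1 * (r / 8 + r / 8))).
  by rewrite ler_pM2l ?invr_gt0// (le_trans (ler_normB _ _))// lerD// ltW.
by rewrite le_eqVlt; apply/orP; left; apply/eqP; rewrite /t; field; rewrite !gt_eqF.
Qed.

(** Iterating [approximate_preimage] on the remaining error produces a
geometrically convergent series of corrections. *)
Lemma bounded_preimage :
  exists2 C : R, 0 < C & forall w, exists2 v, L v = w & `|v| <= C * `|w|.
Proof.
have [C C0 /choice[s Hs]] := approximate_preimage.
exists (2 * C) => [|w]; first by rewrite mulr_gt0.
pose x n := iter n (fun z => z - L (s z)) w.
have xS n : x n.+1 = x n - L (s (x n)) by [].
have xle n : `|x n| <= `|w| * 2^-1 ^+ n.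
  elim: n => [|n IHn]; first by rewrite expr0 mulr1.
  rewrite xS (le_trans (Hs _).2)// exprS mulrCA ler_pM2l// invr_gt0//.
pose u n := s (x n).
have ule n : `|u n| <= geometric (C * `|w|) 2^-1 n.
  by rewrite /geometric/= (le_trans (Hs _).1)// -mulrA ler_pM2l.
have half1 : `|2^-1 : R| < 1 by rewrite ger0_norm// invf_lt1// ltr1n.
have cg := @cvg_geometric_series R (C * `|w|) _ half1.
have cnu : cvgn [normed series u].
  apply: (@series_le_cvg _ _ (geometric (C * `|w|) 2^-1)) => //.
  - by move=> n /=.
  - by move=> n; exact: le_trans (ule n).
  - exact: cvgP cg.
have cu := normed_cvg cnu.
have Lu n : L (series u n) = w - x n.
  elim: n => [|n IHn]; first by rewrite /series /= big_geq// (lin0 lL) subrr.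
  by rewrite seriesSr (linD lL) IHn xS opprB addrA addrAC.
have x0 : x n @[n --> \oo] --> (0 : W).
  apply/cvgrPdist_lt => e e0.
  have /cvgrPdist_lt/(_ e e0) := @cvg_geometric R `|w| _ half1.
  apply: filterS => n; rewrite !sub0r !normrN; apply: le_lt_trans.
  by rewrite (le_trans (xle n))// ler_norm.
exists (limn (series u)).
  have Lw : L (series u n) @[n --> \oo] --> w.
    have -> : (fun n => L (series u n)) = (fun n => w - x n) by apply/funext.
    have : w - x n @[n --> \oo] --> w - 0 by apply: cvgB => //; exact: cvg_cst.
    by rewrite subr0.
  have LC : L (series u n) @[n --> \oo] --> L (limn (series u)).
    by apply: continuous_cvg; [exact: cL|exact: cu].
  exact: (cvg_unique _ LC Lw).
apply: (le_trans (lim_series_norm cnu)).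
have -> : 2 * C * `|w| = limn (series (geometric (C * `|w|) 2^-1)).
  by rewrite (cvg_lim _ cg)//; field.
by apply: lim_series_le => //; exact: cvgP cg.
Qed.

Lemma bounded_inverse : injective L ->
  exists2 C : R, 0 < C & forall v, `|v| <= C * `|L v|.
Proof.
move=> injL; have [C C0 H] := bounded_preimage; exists C => // v.
by have [v' /injL -> ] := H (L v).
Qed.

End OpenMapping.

(** * Linear algebra of a Fredholm operator of index 0 *)

Section InnerProducts.
Context {R : realType} {W : normedModType R} (ip : W -> W -> R).
Hypotheses (bip : is_bilinear ip) (ip_gt0 : forall e : W, e != 0 -> 0 < ip e e).

Lemma ip_suml I (r : seq I) (a : I -> R) (e : I -> W) e' :
  ip (\sum_(i <- r) a i *: e i) e' = \sum_(i <- r) a i * ip (e i) e'.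
Proof.
rewrite (lin_sum (bip.2 e')); apply: eq_bigr => i _.
exact: (linZ (bip.2 e')).
Qed.

Lemma ip_sumr I (r : seq I) (a : I -> R) (e : I -> W) e' :
  ip e' (\sum_(i <- r) a i *: e i) = \sum_(i <- r) a i * ip e' (e i).
Proof.
rewrite (lin_sum (bip.1 e')); apply: eq_bigr => i _.
exact: (linZ (bip.1 e')).
Qed.

Lemma ip_eq0 e : ip e e = 0 -> e = 0.
Proof. by move=> e0; apply: contra_eq e0 => /ip_gt0; rewrite lt_neqAle eq_sym => /andP[]. Qed.

End InnerProducts.

Section LyapunovSchmidt.
Context {R : realType} {E W : normedModType R} (J incl : E -> W)
  (ip : W -> W -> R) (D : set E) (k : nat).
Hypotheses (lJ : linear J) (lincl : linear incl) (injincl : injective incl).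
Hypotheses (bip : is_bilinear ip) (ipC : forall e e', ip e e' = ip e' e)
  (ip_gt0 : forall e : W, e != 0 -> 0 < ip e e).
Hypotheses (dimJ : has_dim [set v | J v = 0] k) (codimJ : has_codim (range J) k).
Hypotheses (D_lker : forall v, D v <-> forall w, ip (J v) (incl w) = 0)
  (D_rker : forall v, D v -> forall w, ip (J w) (incl v) = 0).

(** The range of J is orthogonal to the image of D, and the inner product is
definite. *)
Lemma incl_range_eq0 v w : D v -> incl v = J w -> v = 0.
Proof.
move=> /D_rker/(_ w) + vw; rewrite -vw => /(ip_eq0 ip_gt0).
by rewrite -(lin0 lincl) => /injincl.
Qed.

(** Linear coordinates on the quotient of W by the range of J. *)
Lemma codim_coordinates : exists kappa : W -> 'rV[R]_k,
  linear kappa /\ forall e, kappa e = 0 <-> range J e.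
Proof.
have [b' /(_ _)/cid Hb'] := codimJ.
pose kappa e := projT1 (Hb' e).
have kP e : range J (e - \sum_i kappa e ord0 i *: b' i).
  exact: (projT2 (Hb' e)).1.
have kU e (a : 'rV[R]_k) : range J (e - \sum_i a ord0 i *: b' i) -> kappa e = a.
  exact: (projT2 (Hb' e)).2.
exists kappa; split.
  move=> c u v; apply: kU; have [x _ Jx] := kP u; have [y _ Jy] := kP v.
  exists (c *: x + y) => //; rewrite lJ Jx Jy scalerBr scaler_sumr.
  rewrite addrACA -opprD -big_split/=; congr (_ - _); apply: eq_bigr => i _.
  by rewrite !mxE scalerDl scalerA.
move=> e; split.
  by have := kP e => + ke0; rewrite ke0 big1 ?subr0// => i _; rewrite mxE scale0r.
by move=> re; apply: kU; rewrite big1 ?subr0// => i _; rewrite mxE scale0r.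
Qed.

(** The image of ker J, which is contained in D, meets the range of J
trivially, and the quotient by this range has the same dimension k. Hence W is
the direct sum of the range of J and the span of the incl (b i), for b a basis
of ker J, and the finite rank term of L maps ker J isomorphically onto this
span: its matrix in the bases b and incl b is the Gram matrix of b, which is
invertible since the inner product is definite. *)
Lemma lyapunov_schmidt : exists b : 'I_k -> E,
  let L v := J v + \sum_i ip (incl (b i)) (incl v) *: incl (b i) in
  [/\ forall i, D (b i), injective L, forall e, exists v, L v = e &
      \matrix_(i, j) ip (incl (b i)) (incl (b j)) \in unitmx].
Proof.
have [b [Jb0 bU]] := dimJ; exists b; rewrite /= in Jb0 bU; move=> L.
have [kappa [lkappa kappa0]] := codim_coordinates.
pose comb (c : 'rV[R]_k) := \sum_i c ord0 i *: b i.
have lcomb : linear comb.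
  move=> a c c'; rewrite /comb scaler_sumr -big_split/=; apply: eq_bigr => i _.
  by rewrite !mxE scalerDl scalerA.
have Jcomb c : J (comb c) = 0.
  by rewrite (lin_sum lJ) big1// => i _; rewrite (linZ lJ) Jb0 scaler0.
have inj_comb c : comb c = 0 -> c = 0.
  move=> c0; have [a [_ aU]] := bU 0 (lin0 lJ).
  rewrite -(aU c); last exact: esym c0.
  by apply: aU; rewrite big1// => i _; rewrite mxE scale0r.
have kerD v : J v = 0 -> D v.
  by move=> Jv; apply/D_lker => w; rewrite Jv; exact: (lin0 (bip.2 _)).
have inclcomb c : incl (comb c) = \sum_i c ord0 i *: incl (b i).
  by rewrite (lin_sum lincl); apply: eq_bigr => i _; rewrite (linZ lincl).
pose K : 'M[R]_k := \matrix_i kappa (incl (b i)).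
have cK c : c *m K = kappa (incl (comb c)).
  rewrite inclcomb (lin_sum lkappa) mulmx_sum_row; apply: eq_bigr => i _.
  by rewrite (linZ lkappa) rowK.
(* A combination of the b i with image in the range of J is 0. *)
have uK : K \in unitmx.
  rewrite -row_free_unit; apply: inj_row_free => c; rewrite cK => /kappa0[w _ /esym Jw].
  by apply/inj_comb/(incl_range_eq0 _ Jw)/kerD/Jcomb.
pose Q : 'M[R]_k := \matrix_(i, j) ip (incl (b i)) (incl (b j)).
pose q v : 'rV[R]_k := \row_i ip (incl (b i)) (incl v).
have qcomb c : q (comb c) = c *m Q.
  apply/rowP => j; rewrite !mxE inclcomb ip_sumr//; apply: eq_bigr => i _.
  by rewrite mxE ipC.
have ipcomb c v : ip (incl (comb c)) (incl v) = \sum_i c ord0 i * q v ord0 i.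
  by rewrite inclcomb ip_suml//; apply: eq_bigr => i _; rewrite mxE.
have qcomb0 c : q (comb c) = 0 -> c = 0.
  move=> qc; apply/inj_comb/injincl; rewrite (lin0 lincl); apply: (ip_eq0 ip_gt0).
  by rewrite ipcomb qc big1// => i _; rewrite mxE mulr0.
have uQ : Q \in unitmx.
  by rewrite -row_free_unit; apply: inj_row_free => c; rewrite -qcomb => /qcomb0.
have LE v : L v = J v + incl (comb (q v)).
  by rewrite inclcomb; congr (_ + _); apply: eq_bigr => i _; rewrite mxE.
have lq : linear q.
  move=> a u v; apply/rowP => i; rewrite !mxE lincl; exact: (bip.1 _).
have lL : linear L.
  by move=> a u v; rewrite !LE lq lJ lcomb lincl scalerDr addrACA.
have D_comb v : J v = 0 -> exists c, v = comb c.
  by move=> /bU[c [-> _]]; exists c.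
split=> //.
- by move=> i; apply/kerD/Jb0.
- suff L0 v : L v = 0 -> v = 0.
    by move=> u v uv; apply/subr0_eq/L0; rewrite (linB lL) uv subrr.
  rewrite LE => /eqP; rewrite addr_eq0 => /eqP Jv.
  have /inj_comb qv : comb (q v) = 0.
    apply: (incl_range_eq0 (w := - v)); first exact/kerD/Jcomb.
    by rewrite (linN lJ) Jv opprK.
  move: Jv; rewrite qv (lin0 lcomb) (lin0 lincl) oppr0 => /D_comb[c vc].
  by move: qv; rewrite vc => /qcomb0 ->; exact: (lin0 lcomb).
- move=> e; pose c := kappa e *m invmx K.
  have : kappa (e - incl (comb c)) = 0.
    by rewrite (linB lkappa) -cK mulmxKV// subrr.
  move=> /kappa0[v0 _ Jv0].
  (* The correction in ker J adjusts the coordinates q of v0 to the prescribed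
  value c. *)
  exists (v0 + comb ((c - q v0) *m invmx Q)).
  rewrite LE (linD lJ) Jcomb addr0 (linD lq) qcomb mulmxKV// [q v0 + _]addrC subrK.
  by rewrite Jv0 subrK.
Qed.

End LyapunovSchmidt.

(** * Charts and smooth families of functionals *)

Section Charts.
Context {R : realType} {M : topologicalType} {E : normedModType R} (c : chart M E).

Lemma ccod_map x : cdom c x -> ccod c (c x).
Proof. by move=> cx; exists x. Qed.

Lemma cdom_inv y : ccod c y -> cdom c (cinv c y).
Proof. by move=> [x cx <-]; rewrite cmapK. Qed.

Lemma cinvK y : ccod c y -> c (cinv c y) = y.
Proof. by move=> [x cx <-]; rewrite cmapK. Qed.

Lemma cdom_near x : cdom c x -> nbhs x (cdom c).
Proof. by move=> cx; apply: open_nbhs_nbhs; split=> //; exact: cdom_open. Qed.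

Lemma ccod_near x : cdom c x -> nbhs (c x) (ccod c).
Proof.
by move=> cx; apply: open_nbhs_nbhs; split; [exact: ccod_open|exact: ccod_map].
Qed.

Lemma cinv_cvg x : cdom c x -> cinv c y @[y --> c x] --> x.
Proof.
move=> cx; rewrite -[X in _ --> X](cmapK cx).
exact: (cinv_continuous (ccod_map cx)).
Qed.

Lemma cmap_cvg x : cdom c x -> c y @[y --> x] --> c x.
Proof. exact: cmap_continuous. Qed.

End Charts.

Section ReferenceCharts.
Context {R : realType} {E : normedModType R} {M : manifold E}.

Lemma chart_at_atlas (x : M) : atlas (chart_at x).
Proof. exact: (s2valP (cid2 (atlas_cover x))). Qed.

Lemma chart_at_dom (x : M) : cdom (chart_at x) x.
Proof. exact: (s2valP' (cid2 (atlas_cover x))). Qed.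

Lemma transition_diff (c d : chart M E) x : atlas c -> atlas d ->
  cdom c x -> cdom d x -> differentiable (d \o cinv c) (c x).
Proof.
move=> ac ad cx dx; have [sm _] := atlas_compatible ac ad.
by apply: (smooth_differentiable sm); exists x.
Qed.

End ReferenceCharts.

Lemma tvec_self {R : realType} {E : normedModType R} {X : manifold E} (x : X) v :
  tvec (chart_at x) x v = v.
Proof.
have cx := chart_at_dom x.
have near_id : \forall y \near chart_at x x, (chart_at x \o cinv (chart_at x)) y = id y.
  by apply: filterS (ccod_near cx) => y cy /=; rewrite cinvK.
have [d1 d1E] := @lin_diff _ E E id (chart_at x x) (fun _ _ _ => erefl) (fun _ => cvg_id).
have [_ H] := diff_near_eq near_id d1.
exact: (etrans (congr1 (fun F => F v) H) (congr1 (fun F => F v) d1E)).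
Qed.

Section SmoothFamilies.
Context {R : realType} {E F : normedModType R} {Lam : manifold F} {X : manifold E}.
Variables (f : Lam -> X -> R) (hf : smooth_family f).

(** The whole family read in a chart of the parameters and a chart of X is
what the smoothness of the family is about. *)
Definition family_loc (phi : chart Lam F) (c : chart X E) (p : F * E) : R^o :=
  f (cinv phi p.1) (cinv c p.2).

Lemma family_diff phi c l x : atlas phi -> atlas c -> cdom phi l -> cdom c x ->
  differentiable (f l \o cinv c : E -> R^o) (c x) /\
  forall v, 'd (f l \o cinv c : E -> R^o) (c x) v =
    dBL (family_loc phi c) (phi l, c x) (0, v).
Proof.
move=> aphi ac lphi cx; have /(_ 1%N) sm := hf aphi ac.
have dom : (ccod phi `*` ccod c) (phi l, c x) by split; exact: ccod_map.
have dF := Ck_differentiable sm dom.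
have [d2 d2E] := @diff_pair_r R E F (phi l) (c x).
have [d3 d3E] := diff_chain d2 dF.
have fE : (f l \o cinv c : E -> R^o) =
    family_loc phi c \o (fun y => (phi l, y)).
  by apply/funext => y; rewrite /family_loc /= cmapK.
rewrite fE; split; first exact: d3.
move=> v; rewrite d3E d2E.
exact: (congr1 (fun F => F (0, v)) (esym (dBLE dF))).
Qed.

Lemma family_member_diff c l x : atlas c -> cdom c x ->
  differentiable (f l \o cinv c : E -> R^o) (c x).
Proof.
move=> ac cx.
exact: (family_diff (chart_at_atlas l) ac (chart_at_dom l) cx).1.
Qed.

(** [tvec] is the change from an arbitrary chart to the reference chart, so
this is the chain rule. *)
Lemma diff_chart c l x : atlas c -> cdom c x ->
  (forall v, 'd (f l \o cinv c : E -> R^o) (c x) v =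
    @fdiff _ _ _ (f l) x (tvec c x v)).
Proof.
move=> ac cx v; rewrite /fdiff /tvec.
have d1 := transition_diff ac (chart_at_atlas x) cx (chart_at_dom x).
have d2 := family_member_diff l (chart_at_atlas x) (chart_at_dom x).
have e1 : (chart_at x \o cinv c) (c x) = chart_at x x by rewrite /= cmapK.
have d2' : differentiable (f l \o cinv (chart_at x) : E -> R^o)
    ((chart_at x \o cinv c) (c x)) by rewrite e1.
have [d3 d3E] := diff_chain d1 d2'.
have near_eq : \forall y \near c x, (f l \o cinv c) y =
    ((f l \o cinv (chart_at x)) \o (chart_at x \o cinv c)) y.
  have H : \forall y \near c x, cdom (chart_at x) (cinv c y).
    by apply: cinv_cvg => //; apply: cdom_near; exact: chart_at_dom.
  by apply: filterS H => y Hy; rewrite /= cmapK.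
have [_ ->] := diff_near_eq near_eq d3.
by rewrite d3E e1.
Qed.

Lemma critical_pullback (h : X -> X) l x : smooth_map h ->
  (forall y, f l (h y) = f l y) -> critical (f l) (h x) -> critical (f l) x.
Proof.
move=> [ch sh] fh crit v; rewrite /fdiff.
set c := chart_at x; set d := chart_at (h x).
have ac : atlas c := chart_at_atlas x; have ad : atlas d := chart_at_atlas (h x).
have cx : cdom c x := chart_at_dom x; have dx : cdom d (h x) := chart_at_dom (h x).
have d1 : differentiable (d \o h \o cinv c) (c x).
  apply: (smooth_differentiable (sh _ _ ac ad)).
  by exists x.
have e1 : (d \o h \o cinv c) (c x) = d (h x) by rewrite /= cmapK.
have d2 : differentiable (f l \o cinv d : E -> R^o) ((d \o h \o cinv c) (c x)).
  by rewrite e1; exact: family_member_diff.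
have [d3 d3E] := diff_chain d1 d2.
have near_eq : \forall y \near c x, (f l \o cinv c) y =
    ((f l \o cinv d) \o (d \o h \o cinv c)) y.
  have H : \forall y \near c x, cdom d (h (cinv c y)).
    have chc : h (cinv c y) @[y --> c x] --> h x.
      exact: (cvg_comp _ _ (cinv_cvg cx) (ch x)).
    exact: (chc _ (cdom_near dx)).
  by apply: filterS H => y Hy; rewrite /= cmapK// fh.
have [_ ->] := diff_near_eq near_eq d3.
by rewrite d3E e1; exact: crit.
Qed.

End SmoothFamilies.

(** * Lie group bundles in adapted charts *)

Section AdaptedCharts.
Context {R : realType} {n m : nat} {Lam : manifold 'rV[R]_n}
  {G : @lie_bundle R n m Lam}.
Variables (phi : chart Lam 'rV[R]_n) (psi : chart G ('rV[R]_n * 'rV[R]_m)%type).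
Hypothesis hpsi : adapted (@src _ _ _ _ G) phi psi.

Lemma adapted_src l a : cdom phi l -> ccod psi (phi l, a) ->
  src (cinv psi (phi l, a)) = l.
Proof.
move=> lphi [g gpsi ga]; rewrite -ga cmapK//.
have [_ _ /(_ _ gpsi)[sphi]] := hpsi; rewrite ga /= => e.
by rewrite -(cmapK lphi) e cmapK.
Qed.

Lemma adaptedE (g : G) : cdom psi g -> psi g = (phi (src g), (psi g).2).
Proof.
by move=> gpsi; have [_ _ /(_ _ gpsi)[_ <-]] := hpsi; case: (psi g).
Qed.

Lemma adapted_phi g : cdom psi g -> cdom phi (src g).
Proof. by move=> gpsi; have [_ _ /(_ _ gpsi)[]] := hpsi. Qed.

Lemma adapted_one l : cdom psi (Defs.one G l) ->
  psi (Defs.one G l) = (phi l, one_loc psi l).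
Proof. by move=> lpsi; rewrite adaptedE// src_one. Qed.

Lemma ccod_one l : cdom psi (Defs.one G l) -> ccod psi (phi l, one_loc psi l).
Proof. by move=> lpsi; rewrite -adapted_one//; exact: ccod_map. Qed.

Lemma cinv_one l : cdom psi (Defs.one G l) ->
  cinv psi (phi l, one_loc psi l) = Defs.one G l.
Proof. by move=> lpsi; rewrite -adapted_one// cmapK. Qed.

Lemma inv_one l : Defs.inv (Defs.one G l) = Defs.one G l.
Proof.
have [+ _] := lb_mulV (Defs.one G l); rewrite src_one => e1.
have [_] := lb_mul1 (Defs.inv (Defs.one G l)); rewrite src_inv src_one => e2.
by rewrite -[LHS]e2 e1.
Qed.

Lemma mulKV (g h : G) : src g = src h -> Defs.mul (Defs.mul g (Defs.inv h)) h = g.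
Proof.
move=> gh; rewrite -lb_mulA ?src_inv// (lb_mulV h).1 -gh.
by rewrite (lb_mul1 g).2.
Qed.

End AdaptedCharts.

Section OrbitMaps.
Context {R : realType} {n m : nat} {Lam : manifold 'rV[R]_n}
  {G : @lie_bundle R n m Lam} {E : normedModType R} {X : manifold E}.
Variables (act : G -> X -> X) (hact : is_action act).
Variables (phi : chart Lam 'rV[R]_n) (psi : chart G ('rV[R]_n * 'rV[R]_m)%type).
Variables (l0 : Lam) (x0 : X).
Hypotheses (hpsi : adapted (@src _ _ _ _ G) phi psi)
  (l0psi : cdom psi (Defs.one G l0)).

Let a0 : 'rV[R]_m := one_loc psi l0.
Let elt (z : Lam * 'rV[R]_m) : G := cinv psi (phi z.1, z.2).

Let l0phi : cdom phi l0.
Proof. by have := adapted_phi hpsi l0psi; rewrite src_one. Qed.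

Lemma chart_pair_cvg : (phi z.1, z.2) @[z --> (l0, a0)] --> (phi l0, a0).
Proof.
have H1 : phi z.1 @[z --> (l0, a0)] --> phi l0.
  exact: (cvg_comp _ _ cvg_fst (cmap_cvg l0phi)).
have H2 : z.2 @[z --> (l0, a0)] --> a0 by exact: cvg_snd.
exact: (cvg_pair H1 H2).
Qed.

Lemma elt_cvg : elt z @[z --> (l0, a0)] --> Defs.one G l0.
Proof.
have := cinv_cvg l0psi; rewrite (adapted_one hpsi)// => H.
exact: (cvg_comp _ _ chart_pair_cvg H).
Qed.

Lemma ccod_pair_near : \forall z \near (l0, a0),
  cdom phi z.1 /\ ccod psi (phi z.1, z.2).
Proof.
have H1 : \forall z \near (l0, a0), cdom phi z.1.
  by apply: (cvg_fst (F := nbhs l0)); exact: cdom_near.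
have H2 : \forall z \near (l0, a0), ccod psi (phi z.1, z.2).
  by apply: chart_pair_cvg; rewrite -(adapted_one hpsi)//; exact: ccod_near.
by near=> z; split; near: z.
Unshelve. all: by end_near. Qed.

Lemma act_elt_cvg : act (elt (z.1.1, z.2)) z.1.2 @[z --> ((l0, x0), a0)] --> x0.
Proof.
have [act1 _ _ cact] := hact.
have H : (elt (z.1.1, z.2), z.1.2) @[z --> ((l0, x0), a0)] --> (Defs.one G l0, x0).
  have cf : (z.1 : Lam * X) @[z --> ((l0, x0), a0)] --> (l0, x0) by exact: cvg_fst.
  have c11 : z.1.1 @[z --> ((l0, x0), a0)] --> l0 by exact: (cvg_comp _ _ cf cvg_fst).
  have c12 : z.1.2 @[z --> ((l0, x0), a0)] --> x0 by exact: (cvg_comp _ _ cf cvg_snd).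
  have c2 : z.2 @[z --> ((l0, x0), a0)] --> a0 by exact: cvg_snd.
  have cg : elt (z.1.1, z.2) @[z --> ((l0, x0), a0)] --> Defs.one G l0.
    exact: (cvg_comp _ _ (cvg_pair c11 c2) elt_cvg).
  exact: (cvg_pair cg c12).
have := cvg_comp _ _ H (cact (Defs.one G l0, x0)).
by rewrite /= act1.
Qed.

Lemma inv_elt_cvg : Defs.inv (elt z) @[z --> (l0, a0)] --> Defs.one G l0.
Proof.
rewrite -[X in _ --> X]inv_one.
exact: (cvg_comp _ _ elt_cvg ((inv_smooth G).1 (Defs.one G l0))).
Qed.

End OrbitMaps.

(** * Differentials of orbit maps away from the unit *)

Section OrbitDerivative.
Context {R : realType} {n m : nat} {Lam : manifold 'rV[R]_n}
  {G : @lie_bundle R n m Lam} {E : normedModType R} {X : manifold E}.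
Variables (act : G -> X -> X) (hact : is_action act) (hreg : regular act).
Variables (phi : chart Lam 'rV[R]_n) (psi : chart G ('rV[R]_n * 'rV[R]_m)%type).
Variables (c : chart X E).
Hypotheses (hpsi : adapted (@src _ _ _ _ G) phi psi) (hc : atlas c).

Let elt (l : Lam) (a : 'rV[R]_m) : G := cinv psi (phi l, a).

Definition mul_loc (p : ('rV[R]_n * 'rV[R]_m) * 'rV[R]_m) : G :=
  Defs.mul (cinv psi p.1) (cinv psi (p.1.1, p.2)).

(** Multiplication of two elements of one fiber, over the point with
coordinate p.1.1, read in one adapted chart. *)
Definition mul_chart p := psi (mul_loc p).

Definition inv_coord l a : 'rV[R]_m := (psi (Defs.inv (elt l a))).2.

(** The coordinates of the pair (g, inverse of g), where g has coordinates
(phi l, a). *)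
Definition mul_point l a := ((phi l, a), inv_coord l a).

(** Conditions under which right translation by the inverse of the element
with coordinates (phi l, a) can be expressed in the chart psi near that
element. They hold near the unit of the fiber over l0. *)
Definition translatable l a := [/\ cdom phi l, ccod psi (phi l, a),
  cdom psi (Defs.inv (elt l a)) & cdom psi (Defs.one G l)].

Lemma translatable_src l a : translatable l a -> src (elt l a) = l.
Proof. by move=> [lphi la _ _]; exact: adapted_src. Qed.

Lemma translatable_inv l a : translatable l a ->
  cinv psi (phi l, inv_coord l a) = Defs.inv (elt l a).
Proof.
move=> tla; have [lphi la ipsi _] := tla.
have := adaptedE hpsi ipsi; rewrite src_inv translatable_src// => <-.
by rewrite cmapK.
Qed.

Lemma mul_loc_point l a : translatable l a -> mul_loc (mul_point l a) = Defs.one G l.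
Proof.
move=> tla; rewrite /mul_loc /mul_point /= translatable_inv// -/(elt l a).
by rewrite (lb_mulV (elt l a)).2 translatable_src.
Qed.

Lemma mul_point_dom l a : translatable l a ->
  [/\ ccod psi (mul_point l a).1, ccod psi ((mul_point l a).1.1, (mul_point l a).2) &
    cdom psi (mul_loc (mul_point l a))].
Proof.
move=> tla; rewrite mul_loc_point//; have [lphi la ipsi opsi] := tla; split => //=.
have := adaptedE hpsi ipsi; rewrite src_inv translatable_src// => <-; exact: ccod_map.
Qed.

Lemma mul_chart_smooth l a : translatable l a ->
  differentiable mul_chart (mul_point l a) /\
  {for mul_point l a, continuous (dBL mul_chart)}.
Proof.
move=> tla; have [_ apsi _] := hpsi.
have := mul_smooth hpsi hpsi apsi 1%N => sm.
by split; [apply: (Ck_differentiable sm)|apply: (Ck_dBL_continuous sm)];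
  exact: mul_point_dom.
Qed.

(** The product of g' with the inverse of g stays in the chart for g' near g
in the fiber, since it is the unit for g' = g. Continuity of the
multiplication is only available on the fiber product, which is why the
sources are compared. *)
Lemma near_mul_loc l a : translatable l a -> \forall a' \near a,
  ccod psi (phi l, a') /\ cdom psi (mul_loc ((phi l, a'), inv_coord l a)).
Proof.
move=> tla; have [lphi la ipsi opsi] := tla.
have cp : (phi l, a') @[a' --> a] --> (phi l, a).
  exact: (differentiable_continuous (diff_pair_r (phi l) a).1).
have H1 : \forall a' \near a, ccod psi (phi l, a').
  by apply: (cp (ccod psi)); apply: open_nbhs_nbhs; split; [exact: ccod_open|exact: la].
have cg : elt l a' @[a' --> a] --> elt l a.
  exact: (cvg_comp _ _ cp (cinv_continuous la)).
have cgi : (elt l a', Defs.inv (elt l a)) @[a' --> a] --> (elt l a, Defs.inv (elt l a)).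
  have cc : Defs.inv (elt l a) @[a' --> a] --> Defs.inv (elt l a).
    move=> A /nbhs_singleton HA. apply: (@filterS _ (nbhs a) _ setT); [by move=> a' _|exact: filterT].
  exact: (cvg_pair cg cc).
have srcE : src (elt l a) = src (Defs.inv (elt l a)) by rewrite src_inv.
have nb : nbhs (Defs.mul (elt l a) (Defs.inv (elt l a))) (cdom psi).
  apply: cdom_near; have := mul_loc_point tla.
  by rewrite /mul_loc /mul_point /= translatable_inv// => ->.
have /subspace_continuousP/(_ (elt l a, Defs.inv (elt l a)) srcE)/(_ _ nb) := @Defs.mul_continuous _ _ _ _ G.
move=> /cgi Hn.
near=> a'.
have la' : ccod psi (phi l, a') by near: a'.
split=> //; rewrite /mul_loc /= translatable_inv//.
have : src (elt l a') = src (Defs.inv (elt l a)) ->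
  cdom psi (Defs.mul (elt l a') (Defs.inv (elt l a))) by near: a'.
by apply; rewrite src_inv (translatable_src tla); exact: adapted_src.
Unshelve. all: by end_near. Qed.

(** Writing g' = (g' g^-1) g, the orbit map of x near g becomes the orbit map
of g x near the unit. *)
Lemma orbit_loc_translate l a x : translatable l a -> \forall a' \near a,
  orbit_loc act phi psi c l x a' =
  orbit_loc act phi psi c l (act (elt l a) x)
    (mul_chart ((phi l, a'), inv_coord l a)).2.
Proof.
move=> tla; have [lphi la ipsi opsi] := tla; have [_ actM _ _] := hact.
apply: filterS (near_mul_loc tla) => a' [la' hpsi'].
have srcl : src (elt l a') = l by exact: adapted_src.
have srch : src (mul_loc ((phi l, a'), inv_coord l a)) = l.
  rewrite /mul_loc /= translatable_inv// src_mul; first exact: srcl.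
  by rewrite src_inv (translatable_src tla); exact: srcl.
rewrite /orbit_loc; congr (c _).
have -> : (phi l, (mul_chart ((phi l, a'), inv_coord l a)).2) =
    psi (mul_loc ((phi l, a'), inv_coord l a)).
  by rewrite (adaptedE hpsi hpsi') srch.
rewrite cmapK// -actM; last by rewrite srch (translatable_src tla).
rewrite /mul_loc /= translatable_inv// mulKV//.
by rewrite (translatable_src tla); exact: srcl.
Qed.

(** Chain rule for [orbit_loc_translate]: differentiability at the unit, for
all base points, propagates to nearby group elements. *)
Lemma orbit_loc_diff l a x : translatable l a -> cdom c (act (elt l a) x) ->
  differentiable (orbit_loc act phi psi c l x) a /\
  forall v, 'd (orbit_loc act phi psi c l x) a v =
    dBL (orbit_loc act phi psi c l (act (elt l a) x)) (one_loc psi l)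
      (dBL mul_chart (mul_point l a) ((0, v), 0)).2.
Proof.
move=> tla xc; have [lphi la ipsi opsi] := tla.
set y := act (elt l a) x.
have [dO _] := hreg hpsi hc opsi xc.
have [dK _] := mul_chart_smooth tla.
pose i1 (a' : 'rV[R]_m) := (phi l, a').
pose i2 (p : 'rV[R]_n * 'rV[R]_m) := (p, inv_coord l a).
have [d1 d1E] := @diff_pair_r R _ _ (phi l) a.
have [d2 d2E] := @diff_pair_l R _ _ (inv_coord l a) (phi l, a).
have [d12 d12E] := diff_chain d1 d2.
have [d3 d3E] := diff_chain d12 dK.
have [ds dsE] := @diff_snd R _ _ (mul_chart (mul_point l a)).
have [d4 d4E] := diff_chain d3 ds.
have e1 : (mul_chart (mul_point l a)).2 = one_loc psi l.
  by rewrite /mul_chart mul_loc_point.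
have dO' : differentiable (orbit_loc act phi psi c l y) (mul_chart (mul_point l a)).2.
  by rewrite e1.
have [d5 d5E] := diff_chain d4 dO'.
have [d6 d6E] := diff_near_eq (orbit_loc_translate x tla) d5.
have eO w := congr1 (fun F => F w) (dBLE dO).
have eK w := congr1 (fun F => F w) (dBLE dK).
split; first exact: d6.
move=> v; rewrite d6E d5E d4E dsE d3E d12E d1E d2E eO eK -e1.
reflexivity.
Qed.

End OrbitDerivative.

Section OrbitStrictDerivative.
Context {R : realType} {n m : nat} {Lam : manifold 'rV[R]_n}
  {G : @lie_bundle R n m Lam} {E : normedModType R} {X : manifold E}.
Variables (act : G -> X -> X) (hact : is_action act) (hreg : regular act).
Variables (phi : chart Lam 'rV[R]_n) (psi : chart G ('rV[R]_n * 'rV[R]_m)%type).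
Variables (c : chart X E) (l0 : Lam) (x0 : X).
Hypotheses (hpsi : adapted (@src _ _ _ _ G) phi psi) (hc : atlas c).
Hypotheses (l0psi : cdom psi (Defs.one G l0)) (x0c : cdom c x0).

Let a0 : 'rV[R]_m := one_loc psi l0.

Lemma translatable_near : \forall z \near (l0, a0), translatable phi psi z.1 z.2.
Proof.
have H1 := ccod_pair_near hpsi l0psi.
have H2 : \forall z \near (l0, a0), cdom psi (Defs.inv (cinv psi (phi z.1, z.2))).
  by apply: (inv_elt_cvg hpsi l0psi); exact: cdom_near.
have H3 : \forall z \near (l0, a0), cdom psi (Defs.one G z.1).
  have H3' : \forall l \near l0, cdom psi (Defs.one G l).
    by apply: (one_smooth G).1; exact: cdom_near.
  exact: (cvg_fst (F := nbhs l0) H3').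
near=> z.
have [z1 z2] : cdom phi z.1 /\ ccod psi (phi z.1, z.2) by near: z.
by split => //; near: z.
Unshelve. all: by end_near. Qed.

Lemma translatable_one : translatable phi psi l0 a0.
Proof. exact: (nbhs_singleton translatable_near). Qed.

Lemma mul_point_cvg :
  mul_point phi psi z.1 z.2 @[z --> (l0, a0)] --> mul_point phi psi l0 a0.
Proof.
have C1 := chart_pair_cvg hpsi l0psi.
have C2 : inv_coord phi psi z.1 z.2 @[z --> (l0, a0)] --> inv_coord phi psi l0 a0.
  have H := cvg_comp _ _ (inv_elt_cvg hpsi l0psi) (cmap_cvg l0psi).
  have -> : inv_coord phi psi l0 a0 = (psi (Defs.one G l0)).2.
    by rewrite /inv_coord (cinv_one hpsi l0psi) inv_one.
  exact: (cvg_comp _ _ H cvg_snd).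
exact: (cvg_pair C1 C2).
Qed.

(** By [orbit_loc_diff] the differential is a composition of two operators,
the differential at the unit of the orbit map of g x and that of the
multiplication; both depend continuously on the group element, on l and on x.
*)
Lemma orbit_strict_diff (e : R) : 0 < e -> \forall z \near ((l0, x0), a0),
  differentiable (orbit_loc act phi psi c z.1.1 z.1.2) (z.2) /\
  forall v, `|'d (orbit_loc act phi psi c z.1.1 z.1.2) (z.2) v
    - 'd (orbit_loc act phi psi c l0 x0) a0 v| <= e * `|v|.
Proof.
move=> e0.
have [act1 _ _ _] := hact.
pose Z := ((Lam * X) * 'rV[R]_m)%type.
pose z0 : Z := ((l0, x0), a0).
have cf : (z : Z).1 @[z --> z0] --> (l0, x0) by exact: cvg_fst.
have c11 : (z : Z).1.1 @[z --> z0] --> l0 by exact: (cvg_comp _ _ cf cvg_fst).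
have c2 : (z : Z).2 @[z --> z0] --> a0 by exact: cvg_snd.
have cla : ((z : Z).1.1, z.2) @[z --> z0] --> (l0, a0) by exact: (cvg_pair c11 c2).
have cact : act (cinv psi (phi z.1.1, z.2)) z.1.2 @[z --> z0] --> x0.
  exact: (act_elt_cvg hact hpsi).
pose A (z : Z) := dBL (orbit_loc act phi psi c z.1.1
  (act (cinv psi (phi z.1.1, z.2)) z.1.2)) (one_loc psi z.1.1).
pose B (z : Z) := dBL (mul_chart psi) (mul_point phi psi z.1.1 z.2).
have e1 : act (cinv psi (phi l0, a0)) x0 = x0.
  by rewrite (cinv_one hpsi l0psi) act1.
have cA : A z @[z --> z0] --> A z0.
  have [_ H] := hreg hpsi hc l0psi x0c.
  have -> : A z0 = dBL (orbit_loc act phi psi c l0 x0) (one_loc psi l0).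
    by rewrite /A /= e1.
  exact: (cvg_comp _ _ (cvg_pair c11 cact) H).
have cB : B z @[z --> z0] --> B z0.
  have [_ H] := mul_chart_smooth hpsi translatable_one.
  exact: (cvg_comp _ _ (cvg_comp _ _ cla mul_point_cvg) H).
have near_diff : \forall z \near z0,
  differentiable (orbit_loc act phi psi c z.1.1 z.1.2) (z.2) /\
  forall v, 'd (orbit_loc act phi psi c z.1.1 z.1.2) (z.2) v =
    A z (B z ((0, v), 0)).2.
  have Hg : \forall z \near z0, translatable phi psi z.1.1 z.2 by exact: (cla _ translatable_near).
  have Hc : \forall z \near z0, cdom c (act (cinv psi (phi z.1.1, z.2)) z.1.2).
    exact: (cact _ (cdom_near x0c)).
  near=> z.
  apply: (orbit_loc_diff hact hreg hpsi hc); by near: z.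
have d0 v : 'd (orbit_loc act phi psi c l0 x0) a0 v = A z0 (B z0 ((0, v), 0)).2.
  exact: (nbhs_singleton near_diff).2.
pose i (v : 'rV[R]_m) : ('rV[R]_n * 'rV[R]_m) * 'rV[R]_m := ((0, v), 0).
have sB : {morph (snd : 'rV[R]_n * 'rV[R]_m -> 'rV[R]_m) : u v / u - v} by [].
have s1 (w : 'rV[R]_n * 'rV[R]_m) : `|w.2| <= `|w|.
  by rewrite prod_normE le_max lexx orbT.
have i1 v : `|i v| <= `|v|.
  by rewrite /i !prod_normE /= !normr0 !ge_max lexx !normr_ge0.
have near_est : \forall z \near z0, forall v,
    `|A z (B z ((0, v), 0)).2 - A z0 (B z0 ((0, v), 0)).2| <= e * `|v|.
  exact: (bl_comp_near sB s1 i1 cA cB e0).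
near=> z.
have [dz dzE] : differentiable (orbit_loc act phi psi c z.1.1 z.1.2) (z.2) /\
  forall v, 'd (orbit_loc act phi psi c z.1.1 z.1.2) (z.2) v =
    A z (B z ((0, v), 0)).2 by near: z.
have Hz : forall v, `|A z (B z ((0, v), 0)).2 - A z0 (B z0 ((0, v), 0)).2| <= e * `|v|.
  by near: z.
split; first exact: dz.
by move=> v; exact: (norm_sub_congr (dzE v) (d0 v) (Hz v)).
Unshelve. all: by end_near. Qed.

End OrbitStrictDerivative.

(** * Invariant functionals *)

Section InvariantFamilies.
Context {R : realType} {n m : nat} {Lam : manifold 'rV[R]_n}
  {G : @lie_bundle R n m Lam} {E : normedModType R} {X : manifold E}.
Variables (act : G -> X -> X) (hact : is_action act) (hreg : regular act).
Variables (f : Lam -> X -> R) (hf : smooth_family f).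
Hypothesis hinv : forall (l : Lam) (x : X) (g : G), src g = l ->
  f l (act g x) = f l x.

Lemma critical_act l x (g : G) : src g = l ->
  critical (f l) (act g x) -> critical (f l) x.
Proof.
move=> gs; have [_ _ /(_ g)[sm _] _] := hact.
by apply: (critical_pullback hf sm) => y; exact: hinv.
Qed.

Section OneChart.
Variables (phi : chart Lam 'rV[R]_n) (psi : chart G ('rV[R]_n * 'rV[R]_m)%type).
Variable (c : chart X E).
Hypotheses (hpsi : adapted (@src _ _ _ _ G) phi psi) (hc : atlas c).

Lemma orbit_loc_one l x : cdom psi (Defs.one G l) ->
  orbit_loc act phi psi c l x (one_loc psi l) = c x.
Proof.
have [act1 _ _ _] := hact.
by move=> lpsi; rewrite /orbit_loc (cinv_one hpsi lpsi) act1.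
Qed.

Lemma fiber_elt_cvg l : cdom psi (Defs.one G l) ->
  cinv psi (phi l, a) @[a --> one_loc psi l] --> Defs.one G l.
Proof.
move=> lpsi.
have cp : (phi l, a) @[a --> one_loc psi l] --> (phi l, one_loc psi l).
  exact: (differentiable_continuous (diff_pair_r (phi l) (one_loc psi l)).1).
have ci := cinv_continuous (ccod_one hpsi lpsi).
rewrite -[X in _ --> X](cinv_one hpsi lpsi).
exact: (cvg_comp _ _ cp ci).
Qed.

Lemma ccod_fiber_near l : cdom psi (Defs.one G l) ->
  \forall a \near one_loc psi l, ccod psi (phi l, a).
Proof.
move=> lpsi.
have cp : (phi l, a) @[a --> one_loc psi l] --> (phi l, one_loc psi l).
  exact: (differentiable_continuous (diff_pair_r (phi l) (one_loc psi l)).1).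
apply: (cp (ccod psi)); apply: open_nbhs_nbhs.
by split; [exact: ccod_open|exact: ccod_one].
Qed.

Lemma act_fiber_elt_cvg l x : cdom psi (Defs.one G l) ->
  act (cinv psi (phi l, a)) x @[a --> one_loc psi l] --> x.
Proof.
move=> lpsi; have [act1 _ _ cact] := hact.
have cx : (fun=> x) @ nbhs (one_loc psi l) --> x.
  move=> A /nbhs_singleton HA.
  apply: (@filterS _ (nbhs (one_loc psi l)) _ setT); [by move=> a' _|exact: filterT].
have cp : (cinv psi (phi l, a), x) @[a --> one_loc psi l] --> (Defs.one G l, x).
  exact: (cvg_pair (fiber_elt_cvg lpsi) cx).
have := cvg_comp _ _ cp (cact (Defs.one G l, x)).
by rewrite /= act1.
Qed.

Lemma orbit_diff_one l x : cdom psi (Defs.one G l) -> cdom c x ->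
  differentiable (orbit_loc act phi psi c l x) (one_loc psi l).
Proof. by move=> lpsi cx; have [] := hreg hpsi hc lpsi cx. Qed.

(** The functional is constant along its orbits. *)
Lemma diff_along_orbit l x a : cdom psi (Defs.one G l) -> cdom c x ->
  'd (f l \o cinv c : E -> R^o) (c x)
    ('d (orbit_loc act phi psi c l x) (one_loc psi l) a) = 0.
Proof.
move=> lpsi cx.
have lphi : cdom phi l by have := adapted_phi hpsi lpsi; rewrite src_one.
have dO := orbit_diff_one lpsi cx.
have e1 := orbit_loc_one x lpsi.
have df : differentiable (f l \o cinv c : E -> R^o)
    (orbit_loc act phi psi c l x (one_loc psi l)).
  by rewrite e1; exact: family_member_diff.
have [d3 d3E] := diff_chain dO df.
have near_cst : \forall a' \near one_loc psi l,
    cst (f l x : R^o) a' = ((f l \o cinv c) \o orbit_loc act phi psi c l x) a'.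
  have H1 := ccod_fiber_near lpsi.
  have H2 : \forall a' \near one_loc psi l, cdom c (act (cinv psi (phi l, a')) x).
    exact: (act_fiber_elt_cvg lpsi (cdom_near cx)).
  near=> a'.
  have la' : ccod psi (phi l, a') by near: a'.
  have ca' : cdom c (act (cinv psi (phi l, a')) x) by near: a'.
  rewrite /= /orbit_loc cmapK// hinv//.
  exact: (adapted_src hpsi).
have [_ H] := diff_near_eq near_cst d3.
rewrite -e1 -d3E -H diff_cst.
reflexivity.
Unshelve. all: by end_near. Qed.

Lemma orbit_vector_cvg l0 x0 a : cdom psi (Defs.one G l0) -> cdom c x0 ->
  dBL (orbit_loc act phi psi c z.1 z.2) (one_loc psi z.1) a
    @[z --> (l0, x0)] --> dBL (orbit_loc act phi psi c l0 x0) (one_loc psi l0) a.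
Proof.
move=> lpsi cx; have [_ H] := hreg hpsi hc lpsi cx.
exact: (cvg_bl_apply H (cvg_cst a)).
Qed.

(** Let xi y be the infinitesimal motion at y and h y the differential at y.
Since h y (xi y) = 0 and h vanishes at the critical point, h y applied to xi0
equals (h y - h y0) (xi0 - xi y). The first factor is O(y - y0) and the second
tends to 0, so this is o(y - y0) although xi is merely continuous. *)
Lemma hessian_orbit l0 x0 a w : cdom psi (Defs.one G l0) -> cdom c x0 ->
  (forall v, 'd (f l0 \o cinv c : E -> R^o) (c x0) v = 0) ->
  'd (fun y => 'd (f l0 \o cinv c : E -> R^o) y
       ('d (orbit_loc act phi psi c l0 x0) (one_loc psi l0) a) : R^o) (c x0) w = 0.
Proof.
move=> lpsi cx crit.
have lphi : cdom phi l0 by have := adapted_phi hpsi lpsi; rewrite src_one.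
have [aphi _ _] := hpsi.
set xi0 := 'd (orbit_loc act phi psi c l0 x0) (one_loc psi l0) a.
pose xi y := dBL (orbit_loc act phi psi c l0 (cinv c y)) (one_loc psi l0) a.
have xi0E : xi (c x0) = xi0.
  rewrite /xi (cmapK cx).
  exact: (congr1 (fun F => F a) (dBLE (orbit_diff_one lpsi cx))).
have cxi : xi y @[y --> c x0] --> xi0.
  rewrite -xi0E {2}/xi (cmapK cx).
  have cl : (fun=> l0) @ nbhs (c x0) --> l0.
    move=> A /nbhs_singleton HA.
    by apply: (@filterS _ (nbhs (c x0)) _ setT); [move=> y _|exact: filterT].
  exact: (cvg_comp _ _ (cvg_pair cl (cinv_cvg cx)) (orbit_vector_cvg (a := a) lpsi cx)).
pose h y := dBL (family_loc f phi c) (phi l0, y).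
have dh : differentiable h (c x0).
  have /(_ 2%N)[_ [dF _]] := hf aphi hc.
  have [d2 _] := @diff_pair_r R E 'rV[R]_n (phi l0) (c x0).
  have dF' : differentiable (dBL (family_loc f phi c)) (phi l0, c x0).
    by apply: dF; split; exact: ccod_map.
  exact: (diff_chain d2 dF').1.
have hE y v : ccod c y -> 'd (f l0 \o cinv c : E -> R^o) y v = h y (0, v).
  move=> [x xc <-].
  exact: (family_diff hf aphi hc lphi xc).2.
have h0 v : h (c x0) (0, v) = 0 by rewrite -hE ?crit//; exact: ccod_map.
(* The infinitesimal motions are tangent to level sets at every point of the
chart. *)
have hxi y : ccod c y -> h y (0, xi y) = 0.
  move=> [x xc <-]; rewrite -hE; last by exists x.
  have -> : xi (c x) = 'd (orbit_loc act phi psi c l0 x) (one_loc psi l0) a.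
    rewrite /xi (cmapK xc).
    exact: (congr1 (fun F => F a) (dBLE (orbit_diff_one lpsi xc))).
  exact: diff_along_orbit.
pose g y : R^o := 'd (f l0 \o cinv c : E -> R^o) y xi0.
have [k k0 hk] := linear_lipschitz (diff_continuous dh).
have hlip := diff_near dh ltr01.
have ch : t + c x0 @[t --> (0 : E)] --> c x0.
  have : t + c x0 @[t --> (0 : E)] --> 0 + c x0.
    by apply: cvgD; [exact: cvg_id|exact: cvg_cst].
  by rewrite add0r.
have gE y : ccod c y -> `|g y| <= `|h y - h (c x0)| * `|xi0 - xi y|.
  move=> cy; rewrite /g hE//.
  have -> : h y (0, xi0) = (h y - h (c x0)) (0, xi0 - xi y).
    have -> : ((0 : 'rV[R]_n), xi0 - xi y) = (0, xi0) - (0, xi y).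
      by congr (_, _); rewrite ?subr0.
    rewrite (linB (@bl_linear _ _ _ (h y - h (c x0)))).
    have e v : (h y - h (c x0)) (0, v) = h y (0, v).
      by rewrite -[RHS]subr0 -(h0 v).
    rewrite !e (hxi _ cy) subr0; reflexivity.
  rewrite (le_trans (bl_norm_le _ _))// ler_wpM2l//.
  by rewrite prod_normE /= normr0 ge_max normr_ge0 lexx.
suff [_ ->] : differentiable g (c x0) /\ 'd g (c x0) = (\0 : {linear E -> R^o}) :> (E -> R^o) by [].
apply: diff_of_estimate; first exact: cst_continuous.
move=> e e0.
have d0 : 0 < e / (k + 1) by rewrite divr_gt0// addr_gt0.
have cxi' : xi (t + c x0) @[t --> (0 : E)] --> xi0 by exact: (cvg_comp _ _ ch cxi).
have /cvgrPdist_le/(_ _ d0) Hxi := cxi'.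
have Hc : \forall t \near (0 : E), ccod c (t + c x0) by exact: (ch _ (ccod_near cx)).
have g0 : g (c x0) = 0 by rewrite /g crit.
near=> t.
have tc : ccod c (t + c x0) by near: t.
have t1 : `|xi0 - xi (t + c x0)| <= e / (k + 1) by near: t.
have t2 : `|h (t + c x0) - h (c x0) - 'd h (c x0) t| <= 1 * `|t| by near: t.
rewrite g0 /= !subr0 (le_trans (gE _ tc))//.
have t3 : `|h (t + c x0) - h (c x0)| <= (k + 1) * `|t|.
  rewrite -(subrK ('d h (c x0) t) (h (t + c x0) - h (c x0))).
  rewrite (le_trans (ler_normD _ _))// mulrDl addrC lerD//.
apply: (le_trans (ler_pM (normr_ge0 _) (normr_ge0 _) t3 t1)).
rewrite le_eqVlt; apply/orP; left; apply/eqP; field.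
by rewrite gt_eqF// addr_gt0.
Unshelve. all: by end_near. Qed.

End OneChart.

(** The image of the differential of the orbit map is the same in all adapted
charts, because the transition maps preserve the fibers. *)
Lemma orbit_tangent_chart phi psi l x w :
  adapted (@src _ _ _ _ G) phi psi -> cdom psi (Defs.one G l) ->
  @orbit_tangent _ _ _ _ _ _ _ act l x w ->
  exists a, 'd (orbit_loc act phi psi (chart_at x) l x) (one_loc psi l) a = w.
Proof.
move=> hpsi lpsi [phi' [psi' [hpsi' lpsi' [b <-]]]].
have ac := chart_at_atlas x; have cx := chart_at_dom x.
set c := chart_at x.
have [_ apsi _] := hpsi; have [_ apsi' _] := hpsi'.
have lphi' : cdom phi' l by have := adapted_phi hpsi' lpsi'; rewrite src_one.
(* The change of adapted charts restricted to the fiber over l. *)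
pose tau a' := (psi (cinv psi' (phi' l, a'))).2.
have [d1 d1E] := @diff_pair_r R _ _ (phi' l) (one_loc psi' l).
have d2 : differentiable (psi \o cinv psi') (phi' l, one_loc psi' l).
  by rewrite -(adapted_one hpsi' lpsi'); exact: transition_diff.
have [d3 d3E] := diff_chain d1 d2.
have [d4 _] := @diff_snd R _ _ ((psi \o cinv psi') (phi' l, one_loc psi' l)).
have d5 : differentiable tau (one_loc psi' l) by exact: (diff_chain d3 d4).1.
have e1 : tau (one_loc psi' l) = one_loc psi l.
  by rewrite /tau (cinv_one hpsi' lpsi').
have d6 := orbit_diff_one hpsi ac lpsi cx.
have [d7 d7E] := diff_chain_at e1 d5 d6.
have near_eq : \forall a' \near one_loc psi' l,
    orbit_loc act phi' psi' c l x a' = (orbit_loc act phi psi c l x \o tau) a'.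
  have H1 := ccod_fiber_near hpsi' lpsi'.
  have H2 : \forall a' \near one_loc psi' l, cdom psi (cinv psi' (phi' l, a')).
    exact: (fiber_elt_cvg hpsi' lpsi' (cdom_near lpsi)).
  near=> a'.
  have la' : ccod psi' (phi' l, a') by near: a'.
  have ga' : cdom psi (cinv psi' (phi' l, a')) by near: a'.
  rewrite /= /orbit_loc; congr (c (act _ x)).
  have -> : (phi l, tau a') = psi (cinv psi' (phi' l, a')).
    by rewrite (adaptedE hpsi ga') (adapted_src hpsi').
  by rewrite cmapK.
have [_ H] := diff_near_eq near_eq d7.
exists ('d tau (one_loc psi' l) b).
exact: (esym (etrans (congr1 (fun F => F b) H) (d7E b))).
Unshelve. all: by end_near. Qed.

End InvariantFamilies.

(** * Orbits meet a slice *)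

Section Slices.
Context {R : realType} {n m : nat} {Lam : manifold 'rV[R]_n}
  {G : @lie_bundle R n m Lam} {E : normedModType R} {X : manifold E}.
Variables (act : G -> X -> X) (hact : is_action act) (hreg : regular act).
Variables (phi : chart Lam 'rV[R]_n) (psi : chart G ('rV[R]_n * 'rV[R]_m)%type).
Variables (c : chart X E) (l0 : Lam) (x0 : X).
Hypotheses (hpsi : adapted (@src _ _ _ _ G) phi psi) (hc : atlas c).
Hypotheses (l0psi : cdom psi (Defs.one G l0)) (x0c : cdom c x0).
Variables (d : nat) (q : E -> 'rV[R]_d) (T : 'rV[R]_d -> 'rV[R]_m).
Hypotheses (lq : linear q) (cq : continuous q) (lT : linear T) (cT : continuous T).
Hypothesis qT : forall b,
  q ('d (orbit_loc act phi psi c l0 x0) (one_loc psi l0) (T b)) = b.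

Let a0 : 'rV[R]_m := one_loc psi l0.

Let shift_cvg : (z.1, T z.2 + a0) @[z --> ((l0, x0), (0 : 'rV[R]_d))] --> ((l0, x0), a0).
Proof.
have cf : (z.1 : Lam * X) @[z --> ((l0, x0), (0 : 'rV[R]_d))] --> (l0, x0).
  exact: cvg_fst.
have cs : (z.2 : 'rV[R]_d) @[z --> ((l0, x0), (0 : 'rV[R]_d))] --> (0 : 'rV[R]_d).
  exact: cvg_snd.
have cTa : T b + a0 @[b --> (0 : 'rV[R]_d)] --> a0.
  have e : T 0 + a0 = a0 by rewrite (lin0 lT) add0r.
  rewrite -[X in _ --> X]e.
  exact: (differentiable_continuous (affine_diff lT cT a0 0).1).
have ca : T z.2 + a0 @[z --> ((l0, x0), (0 : 'rV[R]_d))] --> a0.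
  exact: (cvg_comp _ _ cs cTa).
exact: (cvg_pair cf ca).
Qed.

Let Phi (p : Lam * X) (b : 'rV[R]_d) : 'rV[R]_d :=
  q (orbit_loc act phi psi c p.1 p.2 (T b + a0)) + - q (c x0).

(** The choice of T makes the identity the linearization. *)
Let Phi_diff (e : R) : 0 < e -> \forall z \near ((l0, x0), (0 : 'rV[R]_d)),
  differentiable (Phi z.1) (z.2) /\
  forall v, `|'d (Phi z.1) (z.2) v - v| <= e * `|v|.
Proof.
move=> e0.
have [kq kq0 hq] := lin_lipschitz lq cq.
have [kT kT0 hT] := lin_lipschitz lT cT.
have d0 : 0 < e / (kq * kT) by rewrite divr_gt0// mulr_gt0.
have H := orbit_strict_diff hact hreg hpsi hc l0psi x0c d0.
have H' : \forall z \near ((l0, x0), (0 : 'rV[R]_d)),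
  differentiable (orbit_loc act phi psi c z.1.1 z.1.2) (T z.2 + a0) /\
  forall v, `|'d (orbit_loc act phi psi c z.1.1 z.1.2) (T z.2 + a0) v
    - 'd (orbit_loc act phi psi c l0 x0) a0 v| <= e / (kq * kT) * `|v|.
  exact: (shift_cvg H).
apply: filterS H' => z [dO hO].
have [dT dTE] := affine_diff lT cT a0 z.2.
have [d1 d1E] := diff_chain dT dO.
have [dq dqE] := affine_diff lq cq (- q (c x0))
  (orbit_loc act phi psi c z.1.1 z.1.2 (T z.2 + a0)).
have [d2 d2E] := diff_chain d1 dq.
split; first exact: d2.
move=> v.
have dE : 'd (Phi z.1) (z.2) v =
    q ('d (orbit_loc act phi psi c z.1.1 z.1.2) (T z.2 + a0) (T v)).
  apply: (etrans (d2E v)); apply: (etrans (dqE _)); congr (q _).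
  apply: (etrans (d1E v)); exact: (congr1 _ (dTE v)).
apply: (norm_sub_congr dE (esym (qT v))).
rewrite -(linB lq); apply: (le_trans (hq _)).
apply: (@le_trans _ _ (kq * (e / (kq * kT) * (kT * `|v|)))).
  rewrite ler_pM2l//; apply: (le_trans (hO (T v))).
  by rewrite ler_wpM2l// ltW.
rewrite le_eqVlt; apply/orP; left; apply/eqP; field.
by rewrite !gt_eqF.
Qed.

(** With coordinates b along directions T b in the group that q separates, the
condition that g x lies on the slice becomes an equation Phi (l, x) b = 0 in a
finite-dimensional space whose linearization at the unit is the identity. *)
Lemma orbit_meets_slice (N : set X) : nbhs x0 N ->
  \forall p \near (l0, x0), exists g : G,
    [/\ src g = p.1, N (act g p.2) & q (c (act g p.2) - c x0) = 0].
Proof.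
move=> xN.
pose elt (l : Lam) a := cinv psi (phi l, a).
have H1 : \forall z \near ((l0, x0), a0),
    [/\ cdom phi z.1.1, ccod psi (phi z.1.1, z.2) & N (act (elt z.1.1 z.2) z.1.2)].
  have cf : (z.1 : Lam * X) @[z --> ((l0, x0), a0)] --> (l0, x0) by exact: cvg_fst.
  have c11 : z.1.1 @[z --> ((l0, x0), a0)] --> l0 by exact: (cvg_comp _ _ cf cvg_fst).
  have c2 : z.2 @[z --> ((l0, x0), a0)] --> a0 by exact: cvg_snd.
  have cla : (z.1.1, z.2) @[z --> ((l0, x0), a0)] --> (l0, a0).
    exact: (cvg_pair c11 c2).
  have Ha : \forall z \near ((l0, x0), a0), cdom phi z.1.1 /\ ccod psi (phi z.1.1, z.2).
    exact: (cla _ (ccod_pair_near hpsi l0psi)).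
  have Hb : \forall z \near ((l0, x0), a0), N (act (elt z.1.1 z.2) z.1.2).
    exact: (act_elt_cvg hact hpsi l0psi xN).
  near=> z.
  have [z1 z2] : cdom phi z.1.1 /\ ccod psi (phi z.1.1, z.2) by near: z.
  by split; [exact: z1|exact: z2|near: z].
have H2 : \forall z \near ((l0, x0), (0 : 'rV[R]_d)),
    [/\ cdom phi z.1.1, ccod psi (phi z.1.1, T z.2 + a0) &
        N (act (elt z.1.1 (T z.2 + a0)) z.1.2)].
  exact: (shift_cvg H1).
have [[A B] /= [HA /nbhs_normP[r /= r0 HB]] AB] := H2.
have Phi0 : Phi (l0, x0) 0 = 0.
  rewrite /Phi (lin0 lT) add0r /= /orbit_loc (cinv_one hpsi l0psi).
  by have [-> _ _ _] := hact; rewrite subrr.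
have cPhi : {for (l0, x0), continuous (Phi^~ 0)}.
  have ci : (p, a0) @[p --> (l0, x0)] --> ((l0, x0), a0).
    have ca : (fun=> a0) @ nbhs (l0, x0) --> a0 by exact: cvg_cst.
    exact: (cvg_pair (cvg_id (F := nbhs (l0, x0))) ca).
  have c1 : act (elt p.1 a0) p.2 @[p --> (l0, x0)] --> x0.
    exact: (cvg_comp _ _ ci (act_elt_cvg hact hpsi l0psi)).
  have c3 : c (act (elt p.1 a0) p.2) @[p --> (l0, x0)] --> c x0.
    exact: (cvg_comp _ _ c1 (cmap_cvg x0c)).
  have c4 := differentiable_continuous (affine_diff lq cq (- q (c x0)) (c x0)).1.
  have c5 : Phi p 0 @[p --> (l0, x0)] --> q (c x0) + - q (c x0).
    rewrite /Phi (lin0 lT) add0r; exact: (cvg_comp _ _ c3 c4).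
  have e : Phi (l0, x0) 0 = q (c x0) + - q (c x0) by rewrite Phi0 subrr.
  by rewrite -e in c5.
have id_lin : linear (id : 'rV[R]_d -> 'rV[R]_d) by [].
have id_bd (v : 'rV[R]_d) : `|v| <= 1 * `|v| by rewrite mul1r.
have Hz := implicit_zero_exists (K := id) id_lin (fun _ => erefl)
  ltr01 id_bd Phi_diff cPhi Phi0 r0.
near=> p.
have Ap : A p by near: p.
have [b br Pb] : exists2 b, `|0 - b| < r & Phi p b = 0 by near: p.
have Bb : B b by exact: HB.
have [/= p1 p2 pN] := AB (p, b) (conj Ap Bb).
exists (elt p.1 (T b + a0)); split.
- exact: (adapted_src hpsi).
- exact: pN.
- by rewrite (linB lq).
Unshelve. all: by end_near. Qed.

End Slices.

(** * The gradient in a trivialization *)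

Section Trivializations.
Context {R : realType} {E : normedModType R} {X : manifold E}
  {fib : X -> completeNormedModType R} {W : completeNormedModType R}.
Variables (t : trivialization fib W) (x : X).
Hypothesis tx : tbase t x.

Lemma tinv_linear : linear (tinv t x).
Proof.
move=> a w w'; apply: (can_inj (tmapK tx)).
by rewrite (tinvK tx) (tmap_linear tx) !(tinvK tx).
Qed.

Lemma tmap_eq0 e : tmap t (x := x) e = 0 -> e = 0.
Proof.
move=> e0; apply: (can_inj (tmapK tx)).
by rewrite e0 (lin0 (tmap_linear tx)).
Qed.

End Trivializations.

Section Gradients.
Context {R : realType} {E F : normedModType R} {Lam : manifold F}
  {X : manifold E} {W : completeNormedModType R} (B : banach_bundle X W).
Variables (f : Lam -> X -> R) (hf : smooth_family f).
Variables (incl : forall x : X, tangent x -> B x)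
  (ip : forall x, B x -> B x -> R) (delta : Lam -> forall x, B x) (k : nat).
Arguments incl : clear implicits.
Arguments ip : clear implicits.
Hypotheses (lincl : forall x, linear (incl x))
  (hip : forall x, inner_product (ip x)) (hdual : dual_morphism k.+1 incl ip).
Hypothesis grad : forall l x (v : tangent x),
  fdiff (f l) x v = ip x (delta l x) (incl x v).

(** The covector <w, .> at the point with coordinates p.1, where w is the
vector p.2 of the model fiber. *)
Definition dual_loc (t : trivialization B W) (c : chart X E) (p : E * W) :
    BL E R^o :=
  let x := cinv c p.1 in
  toBL (fun v : E => ip x (tinv t x p.2) (incl x (tvec c x v)) : R^o).

Variables (t : trivialization B W) (c : chart X E).
Hypotheses (ht : trivs t) (hc : atlas c).

Lemma dual_locE x w v : cdom c x ->
  dual_loc t c (c x, w) v = ip x (tinv t x w) (incl x (tvec c x v)).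
Proof.
move=> cx; rewrite /dual_loc /= cmapK// toBLE//.
- move=> a u u'.
  have -> : tvec c x (a *: u + u') = a *: tvec c x u + tvec c x u'.
    by rewrite /tvec linearP.
  rewrite lincl; have [bip _ _] := hip x.
  exact: (bip.1 _).
- have ctv : continuous (tvec c x).
    apply: diff_continuous.
    exact: (transition_diff hc (chart_at_atlas x) cx (chart_at_dom x)).
  move=> u; apply: (@continuous_comp _ _ _ (tvec c x)
    (fun v : tangent x => ip x (tinv t x w) (incl x v) : R^o)).
    exact: ctv.
  exact: hdual.1.
Qed.

Lemma dual_loc_cvg x w : cdom c x -> tbase t x ->
  dual_loc t c p @[p --> (c x, w)] --> dual_loc t c (c x, w).
Proof.
move=> cx tx; have H := hdual.2 t c ht hc.
apply: differentiable_continuous; apply: (Ck_differentiable H).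
by split=> //=; exists x.
Qed.

Lemma dual_loc_sum x d (s : 'rV[R]_d) (e : 'I_d -> W) v : cdom c x -> tbase t x ->
  dual_loc t c (c x, \sum_i s ord0 i *: e i) v =
  \sum_i s ord0 i * dual_loc t c (c x, e i) v.
Proof.
move=> cx tx; have [bip _ _] := hip x.
rewrite dual_locE// (lin_sum (tinv_linear tx)).
rewrite (lin_sum (bip.2 _)); apply: eq_bigr => i _.
by rewrite dual_locE// (linZ (tinv_linear tx)); exact: (linZ (bip.2 _)).
Qed.

Lemma dual_loc_opp x w v : cdom c x -> tbase t x ->
  dual_loc t c (c x, - w) v = - dual_loc t c (c x, w) v.
Proof.
move=> cx tx; have [bip _ _] := hip x.
rewrite !dual_locE// (linN (tinv_linear tx)).
exact: (linN (bip.2 _)).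
Qed.

(** The gradient represents the differential. *)
Lemma diff_dual_loc l x v : cdom c x -> tbase t x ->
  'd (f l \o cinv c : E -> R^o) (c x) v =
  dual_loc t c (c x, tmap t (delta l x)) v.
Proof.
move=> cx tx; rewrite dual_locE// (tmapK tx) -grad.
exact: diff_chart.
Qed.

End Gradients.

Section Multipliers.
Context {R : realType} {n m : nat} {Lam : manifold 'rV[R]_n}
  {G : @lie_bundle R n m Lam} {E : normedModType R} {X : manifold E}.
Variables (act : G -> X -> X) (hact : is_action act) (hreg : regular act).
Variables (f : Lam -> X -> R) (hf : smooth_family f).
Hypothesis hinv : forall (l : Lam) (x : X) (g : G), src g = l ->
  f l (act g x) = f l x.
Variables (W : completeNormedModType R) (B : banach_bundle X W).
Variables (incl : forall x : X, tangent x -> B x)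
  (ip : forall x, B x -> B x -> R) (delta : Lam -> forall x, B x) (k : nat).
Arguments incl : clear implicits.
Arguments ip : clear implicits.
Hypotheses (lincl : forall x, linear (incl x))
  (hip : forall x, inner_product (ip x)) (hdual : dual_morphism k.+1 incl ip).
Hypothesis grad : forall l x (v : tangent x),
  fdiff (f l) x v = ip x (delta l x) (incl x v).
Variables (phi : chart Lam 'rV[R]_n) (psi : chart G ('rV[R]_n * 'rV[R]_m)%type).
Variables (c : chart X E) (t : trivialization B W) (l0 : Lam) (x0 : X).
Hypotheses (hpsi : adapted (@src _ _ _ _ G) phi psi) (hc : atlas c) (ht : trivs t).
Hypotheses (l0psi : cdom psi (Defs.one G l0)) (x0c : cdom c x0) (x0t : tbase t x0).

(** Pairing the hypothesis with the infinitesimal motions xi_j at x removes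
the gradient, by [diff_along_orbit], and leaves sum_i s_i <e_i, xi_j> = 0. The
matrix of this system depends continuously on (l, x) and is invertible at (l0,
x0). *)
Lemma multipliers_vanish (d : nat) (e : 'I_d -> W) (a : 'I_d -> 'rV[R]_m) :
  \matrix_(i, j) dual_loc incl ip t c (c x0, e i)
    ('d (orbit_loc act phi psi c l0 x0) (one_loc psi l0) (a j)) \in unitmx ->
  \forall z \near (l0, x0), [/\ cdom c z.2, tbase t z.2 &
    forall s : 'rV[R]_d,
      tmap t (delta z.1 z.2) + \sum_i s ord0 i *: e i = 0 -> s = 0].
Proof.
set M0 := \matrix_(i, j) _ => uM0.
pose M (z : Lam * X) : 'M[R]_d := \matrix_(i, j) dual_loc incl ip t c (c z.2, e i)
  (dBL (orbit_loc act phi psi c z.1 z.2) (one_loc psi z.1) (a j)).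
have c2 : z.2 @[z --> (l0, x0)] --> x0 by exact: cvg_snd.
have c1 : z.1 @[z --> (l0, x0)] --> l0 by exact: cvg_fst.
have ccx : c z.2 @[z --> (l0, x0)] --> c x0 by exact: (cvg_comp _ _ c2 (cmap_cvg x0c)).
have cM i j : M z i j @[z --> (l0, x0)] --> M0 i j.
  have H1 : dual_loc incl ip t c (c z.2, e i) @[z --> (l0, x0)] -->
      dual_loc incl ip t c (c x0, e i).
    have cc : (fun=> e i) @ nbhs (l0, x0) --> e i by exact: cvg_cst.
    have cp : (c z.2, e i) @[z --> (l0, x0)] --> (c x0, e i) by exact: (cvg_pair ccx cc).
    exact: (cvg_comp _ _ cp (dual_loc_cvg hdual ht hc (w := e i) x0c x0t)).
  have H2 := orbit_vector_cvg hreg hpsi hc (a := a j) l0psi x0c.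
  have H3 := cvg_bl_apply H1 H2.
  have -> : M0 i j = dual_loc incl ip t c (c x0, e i)
      (dBL (orbit_loc act phi psi c l0 x0) (one_loc psi l0) (a j)).
    rewrite /M0 mxE; congr (dual_loc _ _ _ _ _ _).
    exact: (congr1 (fun F => F (a j)) (esym (dBLE (orbit_diff_one hreg hpsi hc l0psi x0c)))).
  have -> : (fun z => M z i j) = (fun z => dual_loc incl ip t c (c z.2, e i)
      (dBL (orbit_loc act phi psi c z.1 z.2) (one_loc psi z.1) (a j))).
    by apply/funext => z; rewrite /M mxE.
  exact: H3.
have HM : \forall z \near (l0, x0), M z \in unitmx by exact: (unitmx_near cM uM0).
have Hc : \forall z \near (l0, x0), cdom c z.2 by exact: (c2 _ (cdom_near x0c)).
have x0tn : nbhs x0 (tbase t).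
  by apply: open_nbhs_nbhs; split; [exact: tbase_open|].
have Ht : \forall z \near (l0, x0), tbase t z.2 by exact: (c2 _ x0tn).
have Hp : \forall z \near (l0, x0), cdom psi (Defs.one G z.1).
  have co : Defs.one G z.1 @[z --> (l0, x0)] --> Defs.one G l0.
    exact: (cvg_comp _ _ c1 ((one_smooth G).1 l0)).
  exact: (co _ (cdom_near l0psi)).
near=> z.
have zc : cdom c z.2 by near: z.
have zt : tbase t z.2 by near: z.
have zp : cdom psi (Defs.one G z.1) by near: z.
have zM : M z \in unitmx by near: z.
split=> // s sE.
suff sM : s *m M z = 0 by rewrite -(mulmxK zM s) sM mul0mx.
apply/rowP => j; rewrite [RHS]mxE mxE.
set xi := dBL (orbit_loc act phi psi c z.1 z.2) (one_loc psi z.1) (a j).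
have -> : \sum_i s ord0 i * M z i j = \sum_i s ord0 i * dual_loc incl ip t c (c z.2, e i) xi.
  by apply: eq_bigr => i _; rewrite /M mxE.
rewrite -(dual_loc_sum lincl hip hdual)//.
have -> : \sum_i s ord0 i *: e i = - tmap t (delta z.1 z.2).
  by apply/eqP; rewrite -addr_eq0 addrC sE.
rewrite (dual_loc_opp lincl hip hdual)//.
apply/eqP; rewrite oppr_eq0; apply/eqP.
rewrite -(diff_dual_loc hf lincl hip hdual grad)//.
have -> : xi = 'd (orbit_loc act phi psi c z.1 z.2) (one_loc psi z.1) (a j).
  exact: (congr1 (fun F => F (a j)) (dBLE (orbit_diff_one hreg hpsi hc zp zc))).
exact: (diff_along_orbit hact hreg hf hinv hpsi hc).
Unshelve. all: by end_near. Qed.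

End Multipliers.

Section AugmentedGradient.
Context {R : realType} {E F : normedModType R} {Lam : manifold F}
  {X : manifold E} {W : completeNormedModType R} (B : banach_bundle X W).
Variables (delta : Lam -> forall x, B x) (k : nat).
Hypothesis hCk : Ck_sections k.+1 delta.
Variables (phi : chart Lam F) (t : trivialization B W) (l0 : Lam) (x0 : X).
Hypotheses (hphi : atlas phi) (ht : trivs t).
Hypotheses (l0phi : cdom phi l0) (x0t : tbase t x0).
Variable J : tangent x0 -> B x0.
Hypothesis hvert : vertical_derivative (delta l0) J.
Variables (Q : E -> W) (w0 : W).
Hypotheses (lQ : linear Q) (cQ : continuous Q).

Let c := chart_at x0.
Let cx0 : cdom c x0 := chart_at_dom x0.

(** In the application Q y + w0 is the combination of the e_i with
coefficients q_i(y - y0). *)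
Definition augmented (l : Lam) (y : E) : W :=
  tmap t (delta l (cinv (chart_at x0) y)) + (Q y + w0).

(** The differential of the gradient is continuous in operator norm, and J is
its vertical part at x0. *)
Lemma augmented_strict_diff (e : R) : 0 < e -> \forall z \near (l0, c x0),
  differentiable (augmented z.1) (z.2) /\
  forall v, `|'d (augmented z.1) (z.2) v - (tmap t (J v) + Q v)| <= e * `|v|.
Proof.
move=> e0; have hc : atlas c := chart_at_atlas x0.
pose Psi (p : F * E) : W := tmap t (delta (cinv phi p.1) (cinv c p.2)).
pose D := ccod phi `*` (c @` (cdom c `&` tbase t)).
have CkPsi : Ck k.+1 D Psi := hCk hphi hc ht.
have D0 : D (phi l0, c x0).
  by split; [exact: ccod_map|exists x0].
have dPsi l y : cdom phi l -> D (phi l, y) ->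
    differentiable (fun y => tmap t (delta l (cinv c y))) y /\
    forall v, 'd (fun y => tmap t (delta l (cinv c y))) y v =
      dBL Psi (phi l, y) (0, v).
  move=> lphi Dy; have dP := Ck_differentiable CkPsi Dy.
  have [d1 d1E] := diff_pair_r (phi l) y.
  have [d2 d2E] := diff_chain d1 dP.
  have eP : (fun y => tmap t (delta l (cinv c y))) = Psi \o (fun y => (phi l, y)).
    by apply/funext => y'; rewrite /Psi /= cmapK.
  rewrite eP; split; first exact: d2.
  move=> v; apply: (etrans (d2E v)); rewrite d1E.
  exact: (congr1 (fun F => F (0, v)) (esym (dBLE dP))).
have J0 v : tmap t (J v) = dBL Psi (phi l0, c x0) (0, v).
  rewrite (hvert.2 t ht x0t v).
  exact: (dPsi _ _ l0phi D0).2.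
have c1 : z.1 @[z --> (l0, c x0)] --> l0 by exact: cvg_fst.
have c2 : z.2 @[z --> (l0, c x0)] --> c x0 by exact: cvg_snd.
have cp : (phi z.1, z.2) @[z --> (l0, c x0)] --> (phi l0, c x0).
  exact: (cvg_pair (cvg_comp _ _ c1 (cmap_cvg l0phi)) c2).
have cd : dBL Psi (phi z.1, z.2) @[z --> (l0, c x0)] --> dBL Psi (phi l0, c x0).
  exact: (cvg_comp _ _ cp (Ck_dBL_continuous CkPsi D0)).
have /cvgrPdist_le/(_ _ e0) He := cd.
have H1 : \forall z \near (l0, c x0), cdom phi z.1 by exact: (c1 _ (cdom_near l0phi)).
have H2 : \forall z \near (l0, c x0), (c @` (cdom c `&` tbase t)) z.2.
  have x0tn : nbhs x0 (tbase t).
    by apply: open_nbhs_nbhs; split; [exact: tbase_open|].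
  have h1 : \forall y \near c x0, ccod c y by exact: ccod_near.
  have h2 : \forall y \near c x0, tbase t (cinv c y) by exact: (cinv_cvg cx0 x0tn).
  have h3 : \forall y \near c x0, (c @` (cdom c `&` tbase t)) y.
    near=> y.
    have yc : ccod c y by near: y.
    exists (cinv c y); last exact: cinvK.
    by split; [exact: cdom_inv|near: y].
  exact: (c2 _ h3).
near=> z.
have z1 : cdom phi z.1 by near: z.
have z2 : (c @` (cdom c `&` tbase t)) z.2 by near: z.
have ze : `|dBL Psi (phi l0, c x0) - dBL Psi (phi z.1, z.2)| <= e by near: z.
have Dz : D (phi z.1, z.2) by split => //; exact: ccod_map.
have [dz dzE] := dPsi _ _ z1 Dz.
have [dQ dQE] := affine_diff lQ cQ w0 z.2.
split; first exact: (differentiableD dz dQ).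
move=> v.
have dE : 'd (augmented z.1) (z.2) v = dBL Psi (phi z.1, z.2) (0, v) + Q v.
  apply: (etrans (congr1 (fun F => F v) (diffD dz dQ))).
  exact: (congr2 +%R (dzE v) (dQE v)).
have JE : tmap t (J v) + Q v = dBL Psi (phi l0, c x0) (0, v) + Q v.
  exact: (congr1 (fun w => w + Q v) (J0 v)).
have pair_norm : `|((0, v) : F * E)| <= `|v|.
  by rewrite prod_normE /= normr0 ge_max normr_ge0 lexx.
have key := le_trans
  (bl_norm_le (dBL Psi (phi l0, c x0) - dBL Psi (phi z.1, z.2)) (0, v))
  (ler_pM (normr_ge0 _) (normr_ge0 _) ze pair_norm).
have key1 : `|dBL Psi (phi l0, c x0) (0, v) - dBL Psi (phi z.1, z.2) (0, v)|
    <= e * `|v| := key.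
have key2 := norm_sub_addr (Q v) key1.
exact: (norm_sub_congr dE JE key2).
Unshelve. all: by end_near. Qed.

Lemma augmented_cvg : augmented l (c x0) @[l --> l0] --> augmented l0 (c x0).
Proof.
have hc : atlas c := chart_at_atlas x0.
pose Psi (p : F * E) : W := tmap t (delta (cinv phi p.1) (cinv c p.2)).
have CkPsi : Ck k.+1 (ccod phi `*` (c @` (cdom c `&` tbase t))) Psi := hCk hphi hc ht.
have D0 : (ccod phi `*` (c @` (cdom c `&` tbase t))) (phi l0, c x0).
  by split; [exact: ccod_map|exists x0].
have cP := differentiable_continuous (Ck_differentiable CkPsi D0).
have cc : (fun=> c x0) @ nbhs l0 --> c x0 by exact: cvg_cst.
have cp : (phi l, c x0) @[l --> l0] --> (phi l0, c x0).
  exact: (cvg_pair (cmap_cvg l0phi) cc).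
have cPl : Psi (phi l, c x0) @[l --> l0] --> Psi (phi l0, c x0).
  exact: (cvg_comp _ _ cp cP).
apply: cvgD; last exact: cvg_cst.
have PsiE l : cdom phi l -> Psi (phi l, c x0) = tmap t (delta l (cinv c (c x0))).
  by move=> lphi; rewrite /Psi /= (cmapK lphi).
rewrite -(PsiE _ l0phi); apply: cvg_trans cPl; apply: near_eq_cvg.
by apply: filterS (cdom_near l0phi) => l lphi; rewrite PsiE.
Qed.

End AugmentedGradient.

(** * Critical orbits near a nondegenerate one *)

Theorem mainTheorem1 (R : realType) (n m : nat)
  (Lam : manifold 'rV[R]_n) (hLam : @second_countable Lam)
  (G : @lie_bundle R n m Lam)
  (E : completeNormedModType R) (X : manifold E)
  (act : G -> X -> X) (hact : is_action act) (hreg : regular act)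
  (f : Lam -> X -> R) (hf : smooth_family f)
  (hinv : forall (l : Lam) (x : X) (g : G), src g = l -> f l (act g x) = f l x)
  (l0 : Lam) (x0 : X) (hcrit : critical (f l0) x0)
  (hnondeg : equivariantly_nondegenerate act f l0 x0)
  (hfred : fredholm_structure f l0 x0) :
  exists (U : set Lam) (V : set X) (xx : Lam -> X),
    [/\ open U /\ U l0, open V /\ V x0, forall l, U l -> V (xx l) &
        forall l x, U l -> V x ->
          (critical (f l) x <-> exists2 g : G, src g = l & x = act g (xx l))].
Proof.
have [W [B [incl [ip [k [delta [J [[[hti hip k0 hdual] [grad hCk crit0]]
  [hfredJ hhess hvert]]]]]]]]] := hfred.
case: k k0 hdual hCk => // k _ hdual hCk.
have [lincl injincl _] := hti.
have [bip ipC ip_gt0] := hip x0.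
have lJ := @bl_linear _ _ _ J.
pose c := chart_at x0.
have hc : atlas c := chart_at_atlas x0.
have cx0 : cdom c x0 := chart_at_dom x0.
pose D := @orbit_tangent _ _ _ _ _ _ _ act l0 x0.
have hD : [set v : tangent x0 | forall w, hessian (f l0) x0 v w = 0] = D := hnondeg.2.
have D_lker v : D v <-> forall w, ip x0 (J v) (incl x0 w) = 0.
  by rewrite -hD; split=> H w; [rewrite -hhess; exact: H|rewrite hhess; exact: H].
(* The zero vector lies in the kernel of the second variation, hence in D, so
that there is an adapted chart around the unit over l0. *)
have D0 : D 0.
  by apply/D_lker => w; rewrite bl0; exact: (lin0 (bip.2 _)).
have [phi [psi [hpsi l0psi _]]] := D0.
have [hphi _ _] := hpsi.
have l0phi : cdom phi l0 by have := adapted_phi hpsi l0psi; rewrite src_one.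
pose dO := 'd (orbit_loc act phi psi c l0 x0) (one_loc psi l0).
have orb v : D v -> exists a, dO a = v.
  exact: (orbit_tangent_chart hreg hpsi l0psi).
(* An infinitesimal motion is also in the kernel for the second slot. *)
have D_rker v : D v -> forall w, ip x0 (J w) (incl x0 v) = 0.
  move=> /orb[a <-] w; rewrite -hhess.
  exact: (hessian_orbit hact hreg hf hinv hpsi hc a w l0psi cx0 hcrit).
have [_ [d [d' [dimJ codimJ idx]]]] := hfredJ.
(* The index is 0. *)
have d'd : d' = d.
  by move/eqP: idx; rewrite eq_sym subr_eq0 => /eqP[->].
rewrite d'd in codimJ.
have [b [Db injL surjL uQ]] :=
  lyapunov_schmidt lJ (lincl x0) (@injincl x0) bip ipC ip_gt0 dimJ codimJ D_lker D_rker.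
have [t ht x0t] := trivs_cover B x0.
have lt := tmap_linear x0t.
have [a_ a_b] := choice (fun i => orb _ (Db i)).
pose e_ i : W := tmap t (incl x0 (b i)).
pose q (v : E) : 'rV[R]_d := \row_i ip x0 (incl x0 (b i)) (incl x0 v).
have lq : linear q.
  by move=> a u v; apply/rowP => i; rewrite !mxE (lincl x0); exact: (bip.1 _).
have cq : continuous q.
  move=> v; apply: (cvg_row (F := nbhs v)) => i.
  have cvi := hdual.1 x0 (incl x0 (b i)) v.
  by under eq_cvg do rewrite mxE; rewrite mxE; exact: cvi.
pose combe (s : 'rV[R]_d) : W := \sum_i s ord0 i *: e_ i.
pose Q v := combe (q v).
have lQ : linear Q.
  by move=> a u v; rewrite /Q lq; exact: comb_linear.
have cQ : continuous Q.
  by move=> v; exact: (continuous_comp (cq v) (@comb_continuous _ _ _ e_ (q v))).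
pose L v := tmap t (J v) + Q v.
have LE v : L v = tmap t (J v + \sum_i ip x0 (incl x0 (b i)) (incl x0 v) *: incl x0 (b i)).
  rewrite (linD lt) (lin_sum lt); congr (_ + _); apply: eq_bigr => i _.
  by rewrite (linZ lt) mxE.
have lL : linear L.
  by move=> a u v; rewrite /L lJ lt lQ scalerDr addrACA.
have cL : continuous L.
  move=> v; apply: cvgD; last exact: cQ.
  apply: (@continuous_comp _ _ _ (bl_fun J) (@tmap _ _ _ _ _ t x0)).
    exact: bl_continuous.
  exact: tmap_continuous.
have LI : injective L.
  by move=> u v; rewrite !LE => /(can_inj (tmapK x0t)) /injL.
have LS w : exists v, L v = w.
  have [v Lv] := surjL (tinv t x0 w); exists v.
  by rewrite LE Lv (tinvK x0t).
have [C C0 LC] := bounded_inverse lL cL LS LI.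
have [K KL] := choice LS.
(* T s is a group direction which moves x0 along sum_i r_i b_i with r chosen
so that q takes the value s; the inverse of the Gram matrix converts s into r.
*)
have [T [lT cT qT]] : exists T : 'rV[R]_d -> 'rV[R]_m,
    [/\ linear T, continuous T & forall s, q (dO (T s)) = s].
  pose Qm := \matrix_(i, j) ip x0 (incl x0 (b i)) (incl x0 (b j)) : 'M[R]_d.
  pose S (s : 'rV[R]_d) := \sum_i s ord0 i *: row i (invmx Qm).
  pose T s := \sum_i (S s) ord0 i *: a_ i.
  have lS := @comb_linear _ _ _ (fun i => row i (invmx Qm)).
  have cS := @comb_continuous _ _ _ (fun i => row i (invmx Qm)).
  exists T; split.
  - by move=> a u v; rewrite /T [S _]lS; exact: comb_linear.
  - by move=> v; exact: (continuous_comp (cS v) (@comb_continuous _ _ _ a_ (S v))).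
  - move=> s; rewrite /T linear_sum.
    have -> : \sum_i dO (S s ord0 i *: a_ i) = \sum_i S s ord0 i *: b i.
      by apply: eq_bigr => i _; rewrite linearZ a_b.
    have -> : q (\sum_i S s ord0 i *: b i) = S s *m Qm.
      apply/rowP => j; rewrite !mxE (lin_sum (lincl x0)) (lin_sum (bip.1 _)).
      apply: eq_bigr => i _; rewrite mxE ipC (linZ (lincl x0)).
      exact: (linZ (bip.2 _)).
    by rewrite /S -mulmx_sum_row mulmxKV.
pose Phi := augmented delta t x0 Q (- Q (c x0)).
have dPhi := augmented_strict_diff hCk hphi ht l0phi x0t hvert (- Q (c x0)) lQ cQ.
have cPhi := augmented_cvg hCk hphi ht l0phi x0t (Q := Q) (w0 := - Q (c x0)).
have PhiE l y : Phi l y = tmap t (delta l (cinv c y)) + combe (q (y - c x0)).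
  by rewrite /Phi /augmented -/(Q (y - c x0)) (linB lQ).
have Phi0 : Phi l0 (c x0) = 0.
  rewrite PhiE subrr (cmapK cx0) hvert.1 (lin0 lt) (lin0 lq) add0r.
  by rewrite /combe big1// => i _; rewrite mxE scale0r.
have cPhi0 : {for l0, continuous (Phi^~ (c x0))} by exact: cPhi.
have [r r0 Huniq] := implicit_zero_unique lL C0 LC dPhi.
have Hex := implicit_zero_exists lL KL C0 LC dPhi cPhi0 Phi0.
(* At (l0, x0) the matrix of the system satisfied by the multipliers is the
Gram matrix of b. *)
have uM : \matrix_(i, j) dual_loc incl ip t c (c x0, e_ i) (dO (a_ j)) \in unitmx.
  suff -> : \matrix_(i, j) dual_loc incl ip t c (c x0, e_ i) (dO (a_ j)) =
      \matrix_(i, j) ip x0 (incl x0 (b i)) (incl x0 (b j)) by [].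
  apply/matrixP => i j; rewrite !mxE (dual_locE lincl hip hdual t hc _ _ cx0).
  by rewrite a_b (tmapK x0t) tvec_self.
have Hm := multipliers_vanish hact hreg hf hinv lincl hip hdual grad hpsi hc ht
  l0psi cx0 x0t uM.
have Hm' : \forall z \near (l0, c x0), [/\ cdom c (cinv c z.2), tbase t (cinv c z.2) &
    forall s : 'rV[R]_d, tmap t (delta z.1 (cinv c z.2)) + combe s = 0 -> s = 0].
  have c1 : z.1 @[z --> (l0, c x0)] --> l0 by exact: cvg_fst.
  have c2 : z.2 @[z --> (l0, c x0)] --> c x0 by exact: cvg_snd.
  have c3 : cinv c z.2 @[z --> (l0, c x0)] --> x0 by exact: (cvg_comp _ _ c2 (cinv_cvg cx0)).
  have c4 : (z.1, cinv c z.2) @[z --> (l0, c x0)] --> (l0, x0) by exact: (cvg_pair c1 c3).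
  exact: (c4 _ Hm).
have [[A1 B1] /= [HA1 /nbhs_normP[r1 /= r1_gt0 HB1]] AB1] := Hm'.
(* At a zero of the augmented gradient the multipliers vanish, hence so does
the gradient. *)
have crit_of_zero l y : A1 l -> `|c x0 - y| < r1 -> Phi l y = 0 ->
    critical (f l) (cinv c y).
  move=> lA1 yr1; rewrite PhiE => Py.
  have [yc yt ys] := AB1 (l, y) (conj lA1 (HB1 _ yr1)).
  apply/crit0; apply: (tmap_eq0 yt).
  by rewrite -[RHS]Py (ys _ Py) /combe big1 ?addr0// => i _; rewrite mxE scale0r.
pose r2 := Num.min r r1.
have r2_gt0 : 0 < r2 by rewrite lt_min r0.
(* Orbits are moved into a neighborhood of x0 where zeros of the augmented
gradient are both unique and critical. *)
pose N := [set x | [/\ cdom c x, tbase t x & `|c x0 - c x| < r2]].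
have x0N : nbhs x0 N.
  have H1 := cdom_near cx0.
  have H2 : nbhs x0 (tbase t).
    by apply: open_nbhs_nbhs; split; [exact: tbase_open|].
  have /cvgrPdist_lt/(_ _ r2_gt0) H3 := cmap_cvg cx0.
  by near=> x; split; near: x.
have Hs := orbit_meets_slice hact hreg hpsi hc l0psi cx0 lq cq lT cT qT x0N.
have [[A2 V1] /= [HA2 HV1] AV] := Hs.
have HV : nbhs (c x0) (cinv c @^-1` V1^°).
  apply: (cinv_cvg cx0); exact: nbhs_interior.
have /nbhs_normP[r3 /= r3_gt0 HV3] := HV.
(* The radius r4 forces x_l into the neighborhood of x0 whose orbits meet the
slice; uniqueness in the larger ball of radius r identifies the zeros obtained
for different radii. *)
pose r4 := Num.min r3 r2.
have r4_gt0 : 0 < r4 by rewrite lt_min r3_gt0.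
pose U0 := [set l | [/\ A1 l, A2 l, forall y y', `|c x0 - y| < r -> `|c x0 - y'| < r ->
    Phi l y = 0 -> Phi l y' = 0 -> y = y' &
    exists2 y, `|c x0 - y| < r4 & Phi l y = 0]].
have HU0 : nbhs l0 U0.
  have Hex4 := Hex _ r4_gt0.
  by near=> l; split; near: l.
(* Outside U0 the value of the choice is arbitrary. *)
have /choice[yy Hyy] : forall l, exists y, U0 l -> `|c x0 - y| < r4 /\ Phi l y = 0.
  move=> l; have [[_ _ _ [y yr Py]]|nU] := pselect (U0 l); first by exists y.
  by exists 0.
have crit_act l x (g : G) : src g = l -> critical (f l) x -> critical (f l) (act g x).
  move=> gs xcrit; have [act1 actM _ _] := hact.
  apply: (critical_act hact hf hinv (g := Defs.inv g)); first by rewrite src_inv.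
  by rewrite -actM ?src_inv// (lb_mulV g).1 act1.
exists U0^°, V1^°, (fun l => cinv c (yy l)); split.
- by split; [exact: open_interior|exact: nbhs_singleton (nbhs_interior HU0)].
- by split; [exact: open_interior|exact: nbhs_singleton (nbhs_interior HV1)].
- move=> l /interior_subset lU0; apply: HV3 => /=.
  by have [+ _] := Hyy _ lU0; rewrite lt_min => /andP[].
- move=> l x /interior_subset lU0 /interior_subset xV1.
  have [lA1 lA2 luniq _] := lU0; have [yr4 Py] := Hyy _ lU0.
  have [yr3 yr yr1] : [/\ `|c x0 - yy l| < r3, `|c x0 - yy l| < r & `|c x0 - yy l| < r1].
    by move: yr4; rewrite !lt_min => /and3P[].
  split=> [xcrit|[g gs ->]]; last first.
    by apply: crit_act => //; exact: crit_of_zero.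
  have [g [gs [gc gt gr] gq]] := AV (l, x) (conj lA2 xV1).
  have gcrit := crit_act _ _ _ gs xcrit.
  have gPhi : Phi l (c (act g x)) = 0.
    rewrite PhiE (cmapK gc) gq ((crit0 _ _).1 gcrit) (lin0 (tmap_linear gt)) add0r.
    by rewrite /combe big1// => i _; rewrite mxE scale0r.
  have yE : c (act g x) = yy l.
    by apply: luniq => //; move: gr; rewrite lt_min => /andP[].
  have [act1 actM _ _] := hact.
  exists (Defs.inv g); first by rewrite src_inv.
  by rewrite -yE (cmapK gc) -actM ?src_inv// (lb_mulV g).1 gs act1.
Unshelve. all: by end_near. Qed.
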